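(* Fix an integer $k\ge 1$ and real constants $0<a\le b$. There are a constant $c>0$, depending only on $k,a,b$, and a polynomial-time quantum algorithm such that the following holds. Let $l\ge 1$ be an integer, and let $H=\sum_{j=1}^m w_jP_j$ be a traceless $k$-local Hamiltonian on $n$ qubits, where $P_1,\dots,P_m$ are distinct Pauli terms such that each qubit participates in at most $l$ of them, and the weights $w_1,\dots,w_m$ are chosen independently at random, each with mean zero and with $a\le|w_j|\le b$. Then with high probability over the choice of the weights, $$\lambda_{\min}(H)\ \le\ -\,c\,\frac{m}{\sqrt l},$$ and this is achieved by a product state which the quantum algorithm, given $H$, finds efficiently: it finds a product state $|\phi\rangle$ on the $n$ qubits with $\langle\phi|H|\phi\rangle\le -c\,m/\sqrt l$.
   Context: A Pauli term on $n$ qubits is a tensor product of $n$ operators from $\{I,X,Y,Z\}$; a qubit participates in the term if the operator at that position is not $I$. $H$ being traceless and $k$-local means that each $P_j$ is non-identity at at least one and at most $k$ qubits. $\lambda_{\min}(H)$ is the smallest eigenvalue of $H$. A product state is a tensor product of $n$ single-qubit pure states. ''With high probability'' means: for each fixed $l$, with probability tending to $1$ as $m\to\infty$, uniformly over $n$, over the choice of the Pauli terms, and over the distributions of the weights satisfying the stated conditions. The algorithm ''finds'' such a product state if it outputs a classical description of one with probability at least $2/3$ over its own measurement randomness, in time polynomial in the size of the description of $H$. *)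

(* Defs.v *)
From HB Require Import structures.
From mathcomp Require Import all_boot all_order all_algebra.
From mathcomp Require Import complex.
From mathcomp Require Import all_classical all_reals all_analysis.

Set Implicit Arguments.
Unset Strict Implicit.
Unset Printing Implicit Defensive.

Import Order.TTheory GRing.Theory Num.Theory.

Local Open Scope ring_scope.
Local Open Scope complex_scope.

Definition bit_string (n : nat) := {ffun 'I_n -> 'I_2}.

(* Operators and vectors on n qubits have their coordinates indexed by
   'I_#|bit_string n|, where #|bit_string n| = 2 ^ n, through enum_val / enum_rank. *)
Notation qop R n := 'M[R[i]]_#|bit_string n|.
Notation qvec R n := 'cV[R[i]]_#|bit_string n|.

Definition tensor_op (R : realType) (n : nat) (A : 'I_n -> 'M[R[i]]_2) : qop R n :=
  \matrix_(x, y) \prod_(q < n) A q ((enum_val x : bit_string n) q) ((enum_val y : bit_string n) q).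

Definition tensor_vec (R : realType) (n : nat) (phi : 'I_n -> 'cV[R[i]]_2) : qvec R n :=
  \col_x \prod_(q < n) phi q ((enum_val x : bit_string n) q) 0.

Inductive pauli := PauliI | PauliX | PauliY | PauliZ.

Definition pauli_code (s : pauli) : nat :=
  match s with PauliI => 0 | PauliX => 1 | PauliY => 2 | PauliZ => 3 end.

Definition pauli_decode (c : nat) : pauli :=
  match c with 0%N => PauliI | 1%N => PauliX | 2%N => PauliY | _ => PauliZ end.

Lemma pauli_codeK : cancel pauli_code pauli_decode. Proof. by case. Qed.

HB.instance Definition _ := Countable.copy pauli (can_type pauli_codeK).

Definition pauli_mx (R : realType) (s : pauli) : 'M[R[i]]_2 :=
  match s with
  | PauliI => 1%:M
  | PauliX => \matrix_(x, y) (x != y)%:R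
  | PauliY => \matrix_(x, y) if x == y then 0 else if x == 0 then 0 -i* 1 else 0 +i* 1
  | PauliZ => \matrix_(x, y) if x == y then (-1) ^+ x else 0
  end.

Definition pauli_term (n : nat) := {ffun 'I_n -> pauli}.

Definition participates (n : nat) (p : pauli_term n) (q : 'I_n) : bool :=
  p q != PauliI.

Definition locality (n : nat) (p : pauli_term n) : nat := #|participates p|.

Definition hamiltonian (R : realType) (n m : nat) (P : 'I_m -> pauli_term n)
    (w : 'I_m -> R) : qop R n :=
  \sum_(j < m) (w j)%:C *: tensor_op (fun q => pauli_mx R (P j q)).

(* The order of R[i] is partial: x <= y requires equal imaginary parts. *)
Definition smallest_eigenvalue (R : realType) (N : nat) (A : 'M[R[i]]_N) (x : R[i]) : Prop :=
  eigenvalue A x /\ forall y : R[i], eigenvalue A y -> x <= y.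

Definition expectation_value (R : realType) (N : nat) (A : 'M[R[i]]_N) (psi : 'cV[R[i]]_N) : R[i] :=
  ((map_mx Num.conj psi)^T *m A *m psi) 0 0.

Definition independent_RVs (R : realType) (d : measure_display) (T : measurableType d)
    (mu : probability T R) (m : nat) (w : 'I_m -> {RV mu >-> R}) : Prop :=
  forall (J : {set 'I_m}) (B : 'I_m -> set R), (forall j, measurable (B j)) ->
    mu (\bigcap_(j in [set` J]) (w j @^-1` B j))%classic
    = (\prod_(j in J) mu (w j @^-1` B j)%classic)%E.

(* Random access machines with unit-cost addition, truncated subtraction and
   indirect addressing (no multiplication): polynomial time on such a machine,
   measured in the bit length of the input, coincides with polynomial time on a
   Turing machine. *)

Inductive com :=
| Skip
| Const (r c : nat)
| Add (r a b : nat)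
| Sub (r a b : nat)
| Fetch (r a : nat)
| Store (a b : nat)
| Write (r : nat)
| Seq (c1 c2 : com)
| If (r : nat) (c1 c2 : com)
| While (r : nat) (c : com).

Record machine := Machine { regs : nat -> nat; memory : nat -> nat; written : seq nat }.

Definition upd (f : nat -> nat) (i v : nat) : nat -> nat :=
  fun j => if j == i then v else f j.

Definition set_reg (s : machine) (r v : nat) : machine :=
  Machine (upd (regs s) r v) (memory s) (written s).

(* exec c s t s': started in s, the command c halts in s' after t steps; If and
   While test whether a register is nonzero, Fetch and Store address indirectly. *)
Inductive exec : com -> machine -> nat -> machine -> Prop :=
| exec_skip s : exec Skip s 1 s
| exec_const s r c : exec (Const r c) s 1 (set_reg s r c)
| exec_add s r a b : exec (Add r a b) s 1 (set_reg s r (regs s a + regs s b)%N)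
| exec_sub s r a b : exec (Sub r a b) s 1 (set_reg s r (regs s a - regs s b)%N)
| exec_fetch s r a : exec (Fetch r a) s 1 (set_reg s r (memory s (regs s a)))
| exec_store s a b :
    exec (Store a b) s 1 (Machine (regs s) (upd (memory s) (regs s a) (regs s b)) (written s))
| exec_write s r :
    exec (Write r) s 1 (Machine (regs s) (memory s) (rcons (written s) (regs s r)))
| exec_seq c1 c2 s t1 s1 t2 s2 :
    exec c1 s t1 s1 -> exec c2 s1 t2 s2 -> exec (Seq c1 c2) s (t1 + t2)%N s2
| exec_if_true r c1 c2 s t s' :
    regs s r != 0%N -> exec c1 s t s' -> exec (If r c1 c2) s t.+1 s'
| exec_if_false r c1 c2 s t s' :
    regs s r = 0%N -> exec c2 s t s' -> exec (If r c1 c2) s t.+1 s'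
| exec_while_false r c s : regs s r = 0%N -> exec (While r c) s 1 s
| exec_while_true r c s t1 s1 t2 s2 :
    regs s r != 0%N -> exec c s t1 s1 -> exec (While r c) s1 t2 s2 ->
    exec (While r c) s (t1 + t2).+1 s2.

Definition init (x : seq nat) : machine :=
  Machine (upd (fun=> 0%N) 0 (size x)) (nth 0%N x) [::].

Definition computes (c : com) (x y : seq nat) (t : nat) : Prop :=
  exists2 s : machine, exec c (init x) t s & written s = y.

Definition input_size (x : seq nat) : nat := (\sum_(v <- x) (trunc_log 2 v).+1)%N.

Definition hadamard (R : realType) : 'M[R[i]]_2 :=
  \matrix_(x, y) ((Num.sqrt 2)^-1 * (-1) ^+ (x * y)%N)%:C.

Definition t_gate (R : realType) : 'M[R[i]]_2 :=
  \matrix_(x, y) if x == y then if x == 0 then 1 else (Num.sqrt 2)^-1 +i* (Num.sqrt 2)^-1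
                 else 0.

Definition bit_proj (R : realType) (v : 'I_2) : 'M[R[i]]_2 := delta_mx v v.

Definition on_qubit (R : realType) (N a : nat) (U : 'M[R[i]]_2) : qop R N :=
  tensor_op (fun q : 'I_N => if q == a :> nat then U else 1%:M).

Definition cnot (R : realType) (N a b : nat) : qop R N :=
  on_qubit N a (bit_proj R 0)
  + on_qubit N a (bit_proj R 1) *m on_qubit N b (pauli_mx R PauliX).

(* Gates that do not address qubits below N, and a CNOT whose control is its
   target, act as the identity. *)
Definition gate_op (R : realType) (N : nat) (g : nat * nat * nat) : qop R N :=
  let: (kind, a, b) := g in
  match kind with
  | 0%N => on_qubit N a (hadamard R)
  | 1%N => on_qubit N a (t_gate R)
  | _ => if [&& (a < N)%N, (b < N)%N & a != b] then cnot R N a b else 1%:M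
  end.

Fixpoint decode_gates (s : seq nat) : seq (nat * nat * nat) :=
  match s with
  | kind :: a :: b :: s' => (kind, a, b) :: decode_gates s'
  | _ => [::]
  end.

(* Gate kinds: 0 is H on qubit a, 1 is T on qubit a, any other is CNOT from a
   to b. A circuit is encoded by its number of qubits followed by its gates. *)
Definition circuit_width (circ : seq nat) : nat := head 0%N circ.
Definition circuit_gates (circ : seq nat) : seq (nat * nat * nat) :=
  decode_gates (behead circ).

Definition zero_state (R : realType) (N : nat) : qvec R N :=
  tensor_vec (fun _ : 'I_N => delta_mx 0 0).

Definition final_state (R : realType) (circ : seq nat) : qvec R (circuit_width circ) :=
  foldl (fun psi g => gate_op R (circuit_width circ) g *m psi)
        (zero_state R (circuit_width circ)) (circuit_gates circ).

Definition outcome_probability (R : realType) (circ : seq nat)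
    (y : bit_string (circuit_width circ)) : R[i] :=
  `|final_state R circ (enum_rank y) 0| ^+ 2.

(* On input x, the classical program [prelude] writes a circuit; the circuit is run
   on |0...0> and all its qubits are measured; then the classical program
   [postlude], given the outcome y and x, writes the output. *)

Record quantum_algorithm := QAlg { prelude : com; postlude : com }.

Definition post_input (x : seq nat) (N : nat) (y : bit_string N) : seq nat :=
  N :: [seq nat_of_ord (y q) | q <- enum 'I_N] ++ x.

Definition polynomial_time (A : quantum_algorithm) : Prop :=
  exists C e : nat, forall x : seq nat,
    let bound := (C * input_size x ^ e + C)%N in
    exists (circ : seq nat) (t : nat),
      [/\ computes (prelude A) x circ t, (t <= bound)%N, (circuit_width circ <= bound)%N &
          forall y : bit_string (circuit_width circ), exists (o : seq nat) (t' : nat),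
            computes (postlude A) (post_input x y) o t' /\ (t' <= bound)%N].

Definition outputs_with_probability (R : realType) (A : quantum_algorithm) (x : seq nat)
    (good : seq nat -> Prop) (p : R) : Prop :=
  exists (circ : seq nat) (t : nat), computes (prelude A) x circ t /\
    p%:C <= \sum_(y : bit_string (circuit_width circ) |
                  `[< exists (o : seq nat) (t' : nat),
                        computes (postlude A) (post_input x y) o t' /\ good o >])
              outcome_probability R y.

(* An integer z is given by its positive and its negative part. *)
Definition int_code (z : int) : seq nat :=
  match z with Posz v => [:: v; 0%N] | Negz v => [:: 0%N; v.+1] end.

(* The weight of the j-th term is described by the rational z j / D. *)
Definition hamiltonian_code (n m : nat) (P : 'I_m -> pauli_term n) (D : nat)
    (z : 'I_m -> int) : seq nat :=
  [:: n; m; D] ++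
  flatten [seq [seq pauli_code (P j q) | q <- enum 'I_n] ++ int_code (z j) | j <- enum 'I_m].

(* The Gaussian integer (p - p') + i (r - r') encoded by the entries
   p, p', r, r' of o from position t on. *)
Definition gaussian_at (R : realType) (o : seq nat) (t : nat) : R[i] :=
  ((nth 0%N o t)%:R - (nth 0%N o t.+1)%:R)
  +i* ((nth 0%N o t.+2)%:R - (nth 0%N o t.+3)%:R).

Definition qubit_at (R : realType) (o : seq nat) (q : nat) : 'cV[R[i]]_2 :=
  \col_v gaussian_at R o (8 * q + 4 * v)%N.

Definition normalize (R : realType) (N : nat) (v : 'cV[R[i]]_N) : 'cV[R[i]]_N :=
  (sqrtC (\sum_x `|v x 0| ^+ 2))^-1 *: v.

(* o describes the product state with factors phi: eight numbers per qubit,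
   giving a nonzero, not necessarily normalized, vector with Gaussian integer
   entries. *)
Definition describes_product_state (R : realType) (n : nat) (o : seq nat)
    (phi : 'I_n -> 'cV[R[i]]_2) : Prop :=
  size o = (8 * n)%N /\
  forall q : 'I_n, qubit_at R o q != 0 /\ phi q = normalize (qubit_at R o q).

(* Main.v *)
(* Give every qubit one of two pure states whose Bloch vectors have positive entries
   and differ in all three of them. The energy of such a product state is
   sum_j w_j f_j(b), where b records the choices and f_j is a product of positive
   factors. Let X_v be the change of the energy when v alone is flipped in b = 0, and,
   for a threshold theta < 0, flip exactly the qubits with X_v <= theta. With all other
   weights fixed, every factor of f_j is then antitone in w_j, so E[w_j f_j] <= 0 by
   association, and quantitatively sum_j E[w_j f_j] is at most a negative constant
   times sum_v E|X_v|; the fourth-moment method gives E|X_v| >= const * sqrt(deg v),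
   and sum_v sqrt(deg v) >= m / sqrt l. Changing one weight affects boundedly many
   terms, so Chebyshev's inequality gives concentration.

   The algorithm only sees approximate weights, and a rounding error may move X_v
   across theta. Averaging over many well separated thresholds cures this, since each
   X_v can be moved across at most one of them. The algorithm therefore computes the
   energies exactly on its input, tries all thresholds that yield different flips
   (namely theta just below X_u for some u, or just below 0), and outputs the best
   state; it is deterministic and needs no quantum circuit. *)

Require Import Defs.
From mathcomp Require Import all_boot all_order all_algebra.
From mathcomp Require Import complex.
From mathcomp Require Import all_classical all_reals all_analysis.
From mathcomp Require Import measurable_realfun ring lra zify.

Set Implicit Arguments.
Unset Strict Implicit.
Unset Printing Implicit Defensive.

Import Order.TTheory GRing.Theory Num.Theory.

Local Open Scope ring_scope.
Local Open Scope complex_scope.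

(** * Finite product probability spaces *)

(** The association and moment arguments vary one weight while the others stay fixed, which is
    elementary on a finite product space. The weights, whose laws are arbitrary, are therefore
    rounded to a fine grid and recentred to mean exactly zero; independence turns the grid cells
    into such a space. The stability that protects the algorithm against approximate input also
    absorbs this rounding, so a single perturbation argument covers both errors.

    The Bloch vectors have three tasks. Positive entries make a product of antitone factors
    antitone. Entries that differ in all three directions make every non-identity Pauli factor react
    to a flip. Finally, energies must be exact on a machine that only adds and subtracts: since 9 +
    36 + 4 = 49, the vector (3, 6, 2) / 7 and its cyclic shift (6, 2, 3) / 7 are rational unit
    vectors, so all energies have a common denominator, and both states have spinors with Gaussian
    integer entries. *)

Section FiniteProduct.
Variables (R : realFieldType) (I G : finType) (p : I -> G -> R).
Hypotheses (p_ge0 : forall i g, 0 <= p i g) (p_sum : forall i, \sum_g p i g = 1).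

Definition weight (x : {ffun I -> G}) : R := \prod_i p i (x i).
Definition expect (F : {ffun I -> G} -> R) : R := \sum_x weight x * F x.
Definition set_coord (x : {ffun I -> G}) (i : I) (h : G) : {ffun I -> G} :=
  [ffun j => if j == i then h else x j].
Definition average (i : I) (F : {ffun I -> G} -> R) (x : {ffun I -> G}) : R :=
  \sum_h p i h * F (set_coord x i h).
Definition ignores (i : I) (F : {ffun I -> G} -> R) :=
  forall x h, F (set_coord x i h) = F x.

Lemma set_coord_set x i h h' : set_coord (set_coord x i h) i h' = set_coord x i h'.
Proof. by apply/ffunP => j; rewrite !ffunE; case: eqP. Qed.

Lemma set_coord_id x i : set_coord x i (x i) = x.
Proof. by apply/ffunP => j; rewrite !ffunE; case: eqP => // ->. Qed.

Lemma set_coordE x i h : set_coord x i h i = h.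
Proof. by rewrite ffunE eqxx. Qed.

Lemma set_coordNE x i h j : j != i -> set_coord x i h j = x j.
Proof. by rewrite ffunE => /negbTE ->. Qed.

Lemma set_coordC x i j h h' : i != j ->
  set_coord (set_coord x i h) j h' = set_coord (set_coord x j h') i h.
Proof.
move=> ij; apply/ffunP => k; rewrite !ffunE.
by case: (eqVneq k i) => [->|//]; rewrite (negbTE ij).
Qed.

Lemma weight_ge0 x : 0 <= weight x.
Proof. exact: prodr_ge0. Qed.

Lemma weight_sum : \sum_x weight x = 1.
Proof. by rewrite -(bigA_distr_bigA (fun i g => p i g)) big1. Qed.

Lemma weight_set_coord x i h : weight (set_coord x i h) * p i (x i) = weight x * p i h.
Proof.
rewrite /weight (bigD1 i) //= [in RHS](bigD1 i) //= set_coordE.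
rewrite (eq_bigr (fun j => p j (x j))); last by move=> j ji; rewrite set_coordNE.
by rewrite mulrAC mulrC; ring.
Qed.

Lemma expectD F F' : expect (fun x => F x + F' x) = expect F + expect F'.
Proof. by rewrite /expect -big_split; apply: eq_bigr => x _; rewrite mulrDr. Qed.

Lemma expectZ c F : expect (fun x => c * F x) = c * expect F.
Proof. by rewrite /expect mulr_sumr; apply: eq_bigr => x _; rewrite mulrCA. Qed.

Lemma expect_sum (J : Type) (s : seq J) (Q : pred J) (F : J -> {ffun I -> G} -> R) :
  expect (fun x => \sum_(j <- s | Q j) F j x) = \sum_(j <- s | Q j) expect (F j).
Proof. by rewrite /expect exchange_big /=; apply: eq_bigr => x _; rewrite mulr_sumr. Qed.

Lemma expect_cst c : expect (fun=> c) = c.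
Proof. by rewrite /expect -mulr_suml weight_sum mul1r. Qed.

Lemma eq_expect F F' : F =1 F' -> expect F = expect F'.
Proof. by move=> e; apply: eq_bigr => x _; rewrite e. Qed.

Lemma le_expect F F' : (forall x, F x <= F' x) -> expect F <= expect F'.
Proof. by move=> le; apply: ler_sum => x _; rewrite ler_wpM2l ?weight_ge0. Qed.

Lemma expect_average i F : expect (average i F) = expect F.
Proof.
rewrite /expect /average.
under eq_bigr do rewrite mulr_sumr.
rewrite pair_big /=.
(* Exchanging the coordinate with its resampled value is an involution of the pairs [(x, h)], and by
   [weight_set_coord] it preserves [weight x * p i h]. *)
pose sw (u : {ffun I -> G} * G) := (set_coord u.1 i u.2, u.1 i).
have swK : involutive sw.
  by case=> x h; rewrite /sw /= set_coordE set_coord_set set_coord_id.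
rewrite (reindex_inj (inv_inj swK)) /=.
rewrite -(pair_big xpredT xpredT
  (fun x h => weight (set_coord x i h) * (p i (x i) * F (set_coord (set_coord x i h) i (x i))))) /=.
apply: eq_bigr => x _.
under eq_bigr do rewrite set_coord_set set_coord_id mulrA weight_set_coord mulrAC.
by rewrite -mulr_sumr p_sum mulr1.
Qed.

Lemma averageM i F F' x : ignores i F ->
  average i (fun y => F y * F' y) x = F x * average i F' x.
Proof.
move=> FI; rewrite /average mulr_sumr; apply: eq_bigr => h _.
by rewrite FI mulrCA.
Qed.

Lemma average_ignores i F : ignores i (average i F).
Proof. by move=> x h; apply: eq_bigr => h' _; rewrite set_coord_set. Qed.

Lemma average_id i F x : ignores i F -> average i F x = F x.
Proof.
move=> FI; rewrite /average; under eq_bigr do rewrite FI.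
by rewrite -mulr_suml p_sum mul1r.
Qed.

Lemma ignores_average i j F : ignores i F -> ignores i (average j F).
Proof.
move=> FI x h; have [->|ij] := eqVneq i j; first exact: average_ignores.
by apply: eq_bigr => h' _; rewrite set_coordC // FI.
Qed.

(** The coordinates of [x] are replaced by those of [y] one at a time. *)
Lemma ignores_all F x y : (forall i, ignores i F) -> F x = F y.
Proof.
move=> FI.
suff Fs (s : seq I) : F [ffun j => if j \in s then y j else x j] = F x.
  rewrite -(Fs (enum I)); congr F; apply/ffunP => j.
  by rewrite ffunE mem_enum.
elim: s => [|i s IH]; first by congr F; apply/ffunP => j; rewrite ffunE.
rewrite -IH -[RHS](FI i _ (y i)); congr F; apply/ffunP => j.
by rewrite !ffunE inE; case: eqP => [->|].
Qed.

(** The conditional expectation of [F] given the coordinates outside [s]. *)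
Definition averages (s : seq I) F := foldr average F s.

Lemma expect_averages s F : expect (averages s F) = expect F.
Proof. by elim: s => //= i s IH; rewrite expect_average. Qed.

Lemma averages_ignores s F i : i \in s -> ignores i (averages s F).
Proof.
elim: s => //= j s IH; rewrite inE => /orP[/eqP ->|/IH].
  exact: average_ignores.
exact: ignores_average.
Qed.

Lemma averages_enum F x : averages (enum I) F x = expect F.
Proof.
rewrite -(expect_averages (enum I) F) -[LHS]expect_cst; apply: eq_expect => y.
by apply: ignores_all => i; apply: averages_ignores; rewrite mem_enum.
Qed.

Definition oscillates (i : I) (c : R) (F : {ffun I -> G} -> R) :=
  forall x h, `|F (set_coord x i h) - F x| <= c.

Lemma normB_average j F F' x c :
  (forall h, `|F (set_coord x j h) - F'  h| <= c) ->
  `|average j F x - \sum_h p j h * F' h| <= c.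
Proof.
move=> le; rewrite /average -sumrB (le_trans (ler_norm_sum _ _ _)) //.
rewrite -[leRHS]mul1r -(p_sum j) mulr_suml ler_sum // => h _.
by rewrite -mulrBr normrM ger0_norm // ler_wpM2l.
Qed.

Lemma oscillates_average i j c F : oscillates i c F -> oscillates i c (average j F).
Proof.
move=> osc x h; apply: normB_average => h'.
have [->|ij] := eqVneq i j.
  by rewrite set_coord_set subrr normr0 (le_trans _ (osc x h)).
by rewrite set_coordC.
Qed.

Lemma oscillates_averages i s c F : oscillates i c F -> oscillates i c (averages s F).
Proof. by elim: s => //= j s IH /IH; apply: oscillates_average. Qed.

(** Pythagoras: averaging over a coordinate is an orthogonal projection. *)
Lemma expect_sqrB_average i F :
  expect (fun x => (F x - average i F x) ^+ 2) =
  expect (fun x => F x ^+ 2) - expect (fun x => average i F x ^+ 2).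
Proof.
have FE : expect (fun x => average i F x * F x) = expect (fun x => average i F x ^+ 2).
  rewrite -(expect_average i); apply: eq_expect => x.
  by rewrite averageM ?expr2 //; apply: average_ignores.
rewrite (eq_expect (F' := fun x => F x ^+ 2 + ((- 2) * (average i F x * F x) + average i F x ^+ 2))).
  by rewrite !expectD expectZ FE; ring.
by move=> x; ring.
Qed.

(** Pythagoras is telescoped along [s]. Integrating out [i] loses the mean square of a martingale
    difference, and this difference is at most [c i] because averaging over other coordinates does
    not increase the oscillation in [i]. *)
Lemma expect_sqr_averages s F (c : I -> R) : (forall i, oscillates i (c i) F) ->
  expect (fun x => F x ^+ 2) <= expect (fun x => averages s F x ^+ 2) + \sum_(i <- s) c i ^+ 2.
Proof.
move=> osc; elim: s => [|i s IH] /=; first by rewrite big_nil addr0.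
apply: (le_trans IH); rewrite big_cons addrA lerD2r.
rewrite -lerBlDl -expect_sqrB_average -[leRHS]expect_cst; apply: le_expect => x.
have : `|averages s F x - average i (averages s F) x| <= c i.
  rewrite distrC -[X in _ - X](@average_id i (fun=> averages s F x) x) //.
  by apply: normB_average => h; apply: oscillates_averages.
move=> le; rewrite -real_normK ?num_real // ler_sqr ?nnegrE //.
exact: le_trans le.
Qed.

(* The bounded-difference bound on the variance, along the Doob martingale of F. *)
Lemma variance_le F (c : I -> R) : (forall i, oscillates i (c i) F) ->
  expect (fun x => (F x - expect F) ^+ 2) <= \sum_i c i ^+ 2.
Proof.
move=> osc.
have := expect_sqr_averages (enum I) osc.
have -> : expect (fun x => averages (enum I) F x ^+ 2) = expect F ^+ 2.
  by rewrite -[RHS]expect_cst; apply: eq_expect => x; rewrite averages_enum.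
rewrite big_enum /= => le.
rewrite (eq_expect (F' := fun x => F x ^+ 2 + ((- 2 * expect F) * F x + expect F ^+ 2))).
  by rewrite !expectD expectZ expect_cst; lra.
by move=> x; ring.
Qed.

Lemma chebyshev_le F (c : I -> R) (t : R) : 0 < t ->
  (forall i, oscillates i (c i) F) ->
  \sum_(x | expect F + t <= F x) weight x <= (\sum_i c i ^+ 2) / t ^+ 2.
Proof.
move=> t0 osc; rewrite ler_pdivlMr ?exprn_gt0 //.
apply: le_trans (variance_le osc).
rewrite mulr_suml /expect [leRHS](bigID (fun x => expect F + t <= F x)) /=.
rewrite -[leLHS]addr0 lerD //.
  apply: ler_sum => x le; rewrite ler_wpM2l ?weight_ge0 // ler_sqr ?nnegrE ?(ltW t0) //; lra.
by apply: sumr_ge0 => x _; rewrite mulr_ge0 ?weight_ge0 ?sqr_ge0.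
Qed.

End FiniteProduct.

Arguments eq_expect {R I G p F F'}.

(** The left side is linear in the second and fourth powers, so taking expectations bounds the first
    absolute moment from below without Hölder's inequality. With [y = |x| / t] the claim becomes
    [y * (1 - y + y^3 / 4) >= 0]. *)
Lemma norm_ge_moments (R : realFieldType) (x t : R) : 0 < t -> x ^+ 2 / t - x ^+ 4 / (4 * t ^+ 3) <= `|x|.
Proof.
move=> t0; set y := `|x| / t.
have y0 : 0 <= y by rewrite divr_ge0 // ltW.
have xE : `|x| = y * t by rewrite /y divfK ?gt_eqF.
have x2 : x ^+ 2 = (y * t) ^+ 2 by rewrite -xE real_normK ?num_real.
rewrite (exprM x 2 2) x2 xE -subr_ge0.
have -> : y * t - ((y * t) ^+ 2 / t - ((y * t) ^+ 2) ^+ 2 / (4 * t ^+ 3))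
  = t * y * (1 - y + y ^+ 3 / 4) by field; rewrite gt_eqF.
apply: mulr_ge0; first by rewrite mulr_ge0 // ltW.
(* This product is [y ^+ 3] minus its tangent at 6/5, a rational point close to the minimizer 2 /
   sqrt 3 of [1 - y + y^3 / 4]. *)
have : 0 <= (y + 12 / 5) * (y - 6 / 5) ^+ 2 by rewrite mulr_ge0 ?sqr_ge0 //; lra.
have -> : (y + 12 / 5) * (y - 6 / 5) ^+ 2 = y ^+ 3 - 108 / 25 * y + 432 / 125 by field.
by move=> ?; lra.
Qed.

(** * Moments of weighted sums of independent centred variables *)

Section IndependentSum.
Variables (R : rcfType) (I G : finType) (p : I -> G -> R).
Hypotheses (p_ge0 : forall i g, 0 <= p i g) (p_sum : forall i, \sum_g p i g = 1).
Variables (val : I -> G -> R) (B a2 : R).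
Hypotheses (val_mean : forall i, \sum_g p i g * val i g = 0).
Hypotheses (val_le : forall i g, `|val i g| <= B).
Hypotheses (val_sqr : forall i, a2 <= \sum_g p i g * val i g ^+ 2).
Variables (d : I -> R) (e : R).
Hypotheses (e_ge0 : 0 <= e) (d_le : forall i, `|d i| <= 1).

Let S (s : seq I) (x : {ffun I -> G}) : R := \sum_(i <- s) d i * val i (x i).
Let E := expect p.

Let S_ignores s i : i \notin s -> ignores i (S s).
Proof.
move=> ni x h; rewrite /S big_seq [RHS]big_seq; apply: eq_bigr => j js.
by rewrite set_coordNE //; apply: contraNneq ni => <-.
Qed.

Let term_average i (k : nat) x :
  average p i (fun y => (d i * val i (y i)) ^+ k) x = d i ^+ k * \sum_g p i g * val i g ^+ k.
Proof.
rewrite /average mulr_sumr; apply: eq_bigr => h _.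
by rewrite set_coordE exprMn; ring.
Qed.

Let termE i s (k k' : nat) : i \notin s ->
  E (fun x => S s x ^+ k * (d i * val i (x i)) ^+ k')
  = d i ^+ k' * (\sum_g p i g * val i g ^+ k') * E (fun x => S s x ^+ k).
Proof.
move=> ni; rewrite -[LHS](expect_average p_sum i) -[RHS]expectZ; apply: eq_expect => x.
rewrite averageM ?term_average 1?mulrC // => y h.
by rewrite S_ignores.
Qed.

Let term_ge0 i x : 0 <= (d i * val i (x i)) ^+ 2 <= B ^+ 2.
Proof.
rewrite sqr_ge0 /= -real_normK ?num_real // ler_sqr ?nnegrE ?normr_ge0 ?normrM //.
  by rewrite -[leRHS]mul1r ler_pM.
by apply: le_trans (val_le i (x i)).
Qed.

Lemma sum_sqr_ge s : uniq s -> (forall i, i \in s -> e <= `|d i|) ->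
  (0 <= a2) -> (size s)%:R * (e ^+ 2 * a2) <= E (fun x => S s x ^+ 2).
Proof.
move=> us ds a20; elim: s us ds => [_ _|i s IH /= /andP[ni us] ds].
  by rewrite mul0r /E -(expect_cst p_sum 0) le_expect // => x; rewrite sqr_ge0.
rewrite -natr1 mulrDl mul1r.
have eS : E (fun x => S (i :: s) x ^+ 2) =
    E (fun x => S s x ^+ 2) + d i ^+ 2 * (\sum_g p i g * val i g ^+ 2).
  rewrite /E (eq_expect (F' := fun x => S s x ^+ 2 +
    (2 * (S s x ^+ 1 * (d i * val i (x i)) ^+ 1) +
     S s x ^+ 0 * (d i * val i (x i)) ^+ 2))); last first.
    by move=> x; rewrite /S big_cons; ring.
  rewrite !expectD expectZ -!/(E _) !termE //.
  under eq_bigr do rewrite expr1.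
  rewrite val_mean; have -> : E (fun x => S s x ^+ 0) = 1.
    by rewrite -[RHS](expect_cst p_sum); apply: eq_expect => x; rewrite expr0.
  by ring.
rewrite eS lerD ?IH //; first by move=> j js; apply: ds; rewrite inE js orbT.
rewrite ler_pM ?exprn_ge0 //.
by rewrite -[leRHS]real_normK ?num_real // ler_sqr ?nnegrE // ds ?mem_head.
Qed.

Lemma sum_sqr_le s : uniq s -> E (fun x => S s x ^+ 2) <= (size s)%:R * B ^+ 2.
Proof.
elim: s => [_|i s IH /= /andP[ni us]].
  rewrite mul0r /E (eq_expect (F' := fun=> 0)) ?expect_cst // => x.
  by rewrite /S big_nil expr0n.
rewrite -natr1 mulrDl mul1r /E (eq_expect (F' := fun x => S s x ^+ 2 +
    (2 * (S s x ^+ 1 * (d i * val i (x i)) ^+ 1) + (d i * val i (x i)) ^+ 2))); last first.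
  by move=> x; rewrite /S big_cons; ring.
rewrite !expectD expectZ -!/(E _) !termE //.
under eq_bigr do rewrite expr1.
rewrite val_mean mulr0 mul0r mulr0 add0r lerD ?IH //.
by rewrite -[leRHS](expect_cst p_sum) le_expect // => x; case/andP: (term_ge0 i x).
Qed.

(** In the binomial expansion, the terms in which the old sum or the new summand has exponent one
    vanish by independence and centring. With [n] old summands the rest is at most
    [(3 n^2 + 6 n + 1) B^4], below [3 (n + 1)^2 B^4]. *)
Lemma sum_exp4_le s : uniq s ->
  E (fun x => S s x ^+ 4) <= 3 * B ^+ 4 * (size s)%:R ^+ 2.
Proof.
elim: s => [_|i s IH /= /andP[ni us]].
  rewrite expr0n mulr0 /E (eq_expect (F' := fun=> 0)) ?expect_cst // => x.
  by rewrite /S big_nil expr0n.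
have ES1 : E (fun x => S s x ^+ 1) = 0.
  rewrite {IH us ni} /E; elim: s => [|j s IH].
    by rewrite (eq_expect (F' := fun=> 0)) ?expect_cst // => x; rewrite /S big_nil expr1.
  rewrite (eq_expect (F' := fun x => S s x ^+ 1 + (d j * val j (x j)) ^+ 1)); last first.
    by move=> x; rewrite /S big_cons; ring.
  rewrite expectD IH add0r -(expect_average p_sum j).
  rewrite (eq_expect (F' := fun=> 0)) ?expect_cst // => x; rewrite term_average.
  by under eq_bigr do rewrite expr1; rewrite val_mean mulr0.
rewrite /E (eq_expect (F' := fun x => S s x ^+ 4 +
    (4 * (S s x ^+ 3 * (d i * val i (x i)) ^+ 1) +
    (6 * (S s x ^+ 2 * (d i * val i (x i)) ^+ 2) +
    (4 * (S s x ^+ 1 * (d i * val i (x i)) ^+ 3) + (d i * val i (x i)) ^+ 4))))); last first.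
  by move=> x; rewrite /S big_cons; ring.
rewrite !expectD !expectZ -!/(E _) (termE 3 1) // (termE 1 3) // ES1.
under eq_bigr do rewrite expr1.
rewrite val_mean !mulr0 mul0r !mulr0 !add0r.
have B4 x : (d i * val i (x i)) ^+ 4 <= B ^+ 4.
  rewrite -[4%N]/(2 * 2)%N !exprM; have /andP[t0 tB] := term_ge0 i x.
  by rewrite ler_sqr ?nnegrE // (le_trans t0).
have le4 : E (fun x => (d i * val i (x i)) ^+ 4) <= B ^+ 4.
  by rewrite -[leRHS](expect_cst p_sum) le_expect.
have le2 : E (fun x => S s x ^+ 2 * (d i * val i (x i)) ^+ 2) <= (size s)%:R * B ^+ 4.
  apply: (@le_trans _ _ (E (fun x => B ^+ 2 * S s x ^+ 2))).
    apply: le_expect => // x; rewrite mulrC ler_wpM2r ?sqr_ge0 //.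
    by case/andP: (term_ge0 i x).
  rewrite /E expectZ -/(E _) (_ : _ * B ^+ 4 = B ^+ 2 * ((size s)%:R * B ^+ 2)); last by ring.
  by rewrite ler_wpM2l ?sqr_ge0 ?sum_sqr_le.
have := IH us; set n : R := (size s)%:R; rewrite -natr1 -/n => le44.
have n0 : 0 <= n by rewrite /n ler0n.
have B40 : 0 <= B ^+ 4 by rewrite -[4%N]/(2 * 2)%N exprM sqr_ge0.
by nra.
Qed.

(* Fourth-moment method: [norm_ge_moments] at the scale t times the square root
   of the number of summands. *)
Lemma expect_norm_ge s (t : R) : uniq s -> (forall i, i \in s -> e <= `|d i|) ->
  0 <= a2 -> 0 < t -> 3 * B ^+ 4 <= 2 * (e ^+ 2 * a2) * t ^+ 2 ->
  e ^+ 2 * a2 / (2 * t) * Num.sqrt (size s)%:R <= E (fun x => `|S s x|).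
Proof.
move=> us ds a20 t0 tB.
have [s0|s0] := posnP (size s).
  by rewrite s0 sqrtr0 mulr0 /E -(expect_cst p_sum 0); apply: le_expect.
set q := Num.sqrt (size s)%:R; have q0 : 0 < q by rewrite sqrtr_gt0 ltr0n.
have qE : (size s)%:R = q ^+ 2 by rewrite sqr_sqrtr // ler0n.
have tq0 : 0 < t * q by rewrite mulr_gt0.
apply: (@le_trans _ _ (E (fun x => (t * q)^-1 * S s x ^+ 2 +
    (- (4 * (t * q) ^+ 3)^-1) * S s x ^+ 4))); last first.
  apply: le_expect => // x.
  by apply: le_trans (norm_ge_moments _ tq0); rewrite mulNr ![_^-1 * _]mulrC.
rewrite /E expectD !expectZ -/(E _).
have l2 := sum_sqr_ge us ds a20; have l4 := sum_exp4_le us.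
rewrite qE in l2 l4.
have i0 : 0 < (t * q)^-1 by rewrite invr_gt0.
have j0 : 0 < (4 * (t * q) ^+ 3)^-1 by rewrite invr_gt0 mulr_gt0 // exprn_gt0.
have := ler_wpM2l (ltW i0) l2; have := ler_wpM2l (ltW j0) l4.
set E2 := E _; set E4 := E _ => le4 le2.
apply: le_trans (lerD le2 (_ : - ((4 * (t * q) ^+ 3)^-1 * (3 * B ^+ 4 * q ^+ 2 ^+ 2)) <= _)); last first.
  by rewrite mulNr lerN2.
have tn0 : t != 0 by rewrite gt_eqF.
have qn0 : q != 0 by rewrite gt_eqF.
(* The hypothesis on [t] says that the fourth-moment term takes away at most half of the
   second-moment term. *)
have -> : (t * q)^-1 * (q ^+ 2 * (e ^+ 2 * a2)) - (4 * (t * q) ^+ 3)^-1 * (3 * B ^+ 4 * q ^+ 2 ^+ 2)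
   = q / (4 * t ^+ 3) * (4 * (e ^+ 2 * a2) * t ^+ 2 - 3 * B ^+ 4).
  by field; rewrite tn0 qn0.
have -> : e ^+ 2 * a2 / (2 * t) * q = q / (4 * t ^+ 3) * (2 * (e ^+ 2 * a2) * t ^+ 2).
  by field.
rewrite ler_wpM2l //; last by lra.
by rewrite divr_ge0 ?mulr_ge0 ?exprn_ge0 ?ltW.
Qed.

End IndependentSum.

(** * Energies of product states *)

(* Bloch components, times 7, of the two pure states assigned to a qubit: the
   first is (3, 6, 2) / 7 and the second (6, 2, 3) / 7. *)
Definition bloch_table (code : nat) (b : bool) : nat :=
  match code with
  | 0 => 7
  | 1 => if b then 6 else 3
  | 2 => if b then 2 else 6
  | _ => if b then 3 else 2
  end.

Definition bloch (R : numFieldType) (s : pauli) (b : bool) : R :=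
  (bloch_table (pauli_code s) b)%:R / 7.

Lemma bloch_PauliI (R : numFieldType) b : bloch R PauliI b = 1.
Proof. by rewrite /bloch /= divff // pnatr_eq0. Qed.

Lemma bloch_ge (R : realFieldType) s b : 2 / 7 <= bloch R s b.
Proof. by rewrite /bloch ler_pM2r ?invr_gt0 // ler_nat; case: s; case: b. Qed.

Lemma bloch_ge0 (R : realFieldType) s b : 0 <= bloch R s b.
Proof. by rewrite divr_ge0 ?ler0n. Qed.

Lemma bloch_le1 (R : realFieldType) s b : bloch R s b <= 1.
Proof. by rewrite /bloch ler_pdivrMr // mul1r ler_nat; case: s; case: b. Qed.

Lemma bloch_diff_norm (R : realFieldType) s : s != PauliI ->
  7^-1 <= `|bloch R s true - bloch R s false|.
Proof.
move=> sI; rewrite /bloch -mulrBl normrM [`|7^-1|]ger0_norm //.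
rewrite -[leLHS]mul1r ler_pM2r ?invr_gt0 //.
rewrite ler_normr; apply/orP.
by case: s sI => //= _; [left | right | left]; lra.
Qed.

Lemma prod_bounds (R : realFieldType) (J : finType) (Q : pred J) (F : J -> R) :
  (forall j, 0 <= F j <= 1) -> 0 <= \prod_(j | Q j) F j <= 1.
Proof.
move=> FJ; apply: (big_ind (fun x => 0 <= x <= 1)) => [|x y|j _] //.
  by rewrite ler01 lexx.
by move=> /andP[x0 x1] /andP[y0 y1]; rewrite mulr_ge0 //= mulr_ile1.
Qed.

Section Energy.
Variables (R : rcfType) (n m : nat) (P : 'I_m -> pauli_term n).

Definition term_value (j : 'I_m) (b : 'I_n -> bool) : R := \prod_q bloch R (P j q) (b q).
Definition energy (w : 'I_m -> R) (b : 'I_n -> bool) : R := \sum_j w j * term_value j b.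
Definition slope (j : 'I_m) (v : 'I_n) : R :=
  term_value j (pred1 v) - term_value j pred0.
(** This is X_v of the overview. All flips are judged from the same assignment b = 0, not
    successively, so that X_v is linear in the weights with fixed coefficients: it is a sum of
    independent variables, and the direction in which each weight moves it is known. *)
Definition local_field (w : 'I_m -> R) (v : 'I_n) : R := \sum_j w j * slope j v.
Definition threshold_rule (w : 'I_m -> R) (theta : R) (v : 'I_n) : bool :=
  local_field w v <= theta.

Lemma local_fieldE w v : local_field w v = energy w (pred1 v) - energy w pred0.
Proof. by rewrite /energy -sumrB; apply: eq_bigr => j _; rewrite mulrBr. Qed.

Lemma slopeE j v : slope j v =
  (bloch R (P j v) true - bloch R (P j v) false) * \prod_(q | q != v) bloch R (P j q) false.
Proof.
rewrite /slope /term_value (bigD1 v) //= [X in _ - X](bigD1 v) //= eqxx mulrBl.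
congr (_ * _ - _); apply: eq_bigr => q qv.
by rewrite (negbTE qv).
Qed.

Lemma slope_eq0 j v : ~~ participates (P j) v -> slope j v = 0.
Proof.
by rewrite negbK slopeE => /eqP ->; rewrite !bloch_PauliI subrr mul0r.
Qed.

Lemma slope_le1 j v : `|slope j v| <= 1.
Proof.
rewrite slopeE normrM.
have /andP[p0 p1] := @prod_bounds R 'I_n (predC1 v) (fun q => bloch R (P j q) false)
  (fun q => ltac:(by rewrite bloch_ge0 bloch_le1)).
rewrite [X in _ * X]ger0_norm // mulr_ile1 //.
have := @bloch_ge0 R (P j v) true; have := @bloch_ge0 R (P j v) false.
have := @bloch_le1 R (P j v) true; have := @bloch_le1 R (P j v) false.
by rewrite ler_norml; lra.
Qed.

Lemma prod_bloch_ge j k (Q : pred 'I_n) (b : 'I_n -> bool) : (locality (P j) <= k)%N ->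
  (2 / 7) ^+ k <= \prod_(q | Q q) bloch R (P j q) (b q).
Proof.
move=> lk; rewrite (bigID (participates (P j))) /= [X in _ <= _ * X]big1 ?mulr1; last first.
  by move=> q /andP[_]; rewrite negbK => /eqP ->; rewrite bloch_PauliI.
apply: (@le_trans _ _ (\prod_(q | Q q && participates (P j) q) (2 / 7))); last first.
  by apply: ler_prod => q _; rewrite bloch_ge andbT; lra.
rewrite prodr_const; apply: ler_wiXn2l; [lra | lra |].
apply: leq_trans lk; apply: subset_leq_card; apply/fintype.subsetP => q.
by case/andP.
Qed.

Lemma slope_ge j v k : (locality (P j) <= k)%N -> participates (P j) v ->
  7^-1 * (2 / 7) ^+ k <= `|slope j v|.
Proof.
move=> lk pv; have g0 := prod_bloch_ge (predC1 v) (fun=> false) lk.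
have z0 : 0 <= 2 / 7 :> R by lra.
rewrite slopeE normrM; apply: ler_pM; [by rewrite invr_ge0 | exact: exprn_ge0 | |].
  exact: bloch_diff_norm.
by rewrite ger0_norm // prodr_ge0 // => q _; apply: bloch_ge0.
Qed.

Lemma term_value_bounds j b : 0 <= term_value j b <= 1.
Proof. by apply: prod_bounds => q; rewrite bloch_ge0 bloch_le1. Qed.

Lemma eq_term_value j b b' :
  {in participates (P j), b =1 b'} -> term_value j b = term_value j b'.
Proof.
move=> e; apply: eq_bigr => q _; have [/eqP ->|pq] := boolP (P j q == PauliI).
  by rewrite !bloch_PauliI.
by rewrite e.
Qed.

(* The sign of the slope of a term at v is the sign of the change of its factor at
   v, so that a larger weight can only decrease the factor. *)
Lemma factor_antitone (w w' : 'I_m -> R) (j : 'I_m) (theta : R) (v : 'I_n) :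
  (forall i, i != j -> w i = w' i) -> w j <= w' j ->
  bloch R (P j v) (threshold_rule w' theta v) <= bloch R (P j v) (threshold_rule w theta v).
Proof.
move=> ww le; rewrite /threshold_rule.
have fE u : local_field u v = u j * slope j v + \sum_(i | i != j) u i * slope i v.
  by rewrite /local_field (bigD1 j).
have -> : local_field w' v = local_field w v + (w' j - w j) * slope j v.
  rewrite !fE (eq_bigr (fun i => w i * slope i v)) => [|i /ww -> //].
  by ring.
set x := local_field w v; rewrite slopeE.
set p := \prod_(q | _) _; have p0 : 0 <= p by apply: prodr_ge0 => q _; apply: bloch_ge0.
set t := bloch R (P j v) true; set f := bloch R (P j v) false.
have wp : 0 <= (w' j - w j) * p by rewrite mulr_ge0 // subr_ge0.
have [tf|ft] := leP f t.
  have -> : x + (w' j - w j) * ((t - f) * p) = x + (t - f) * ((w' j - w j) * p) by ring.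
  have : 0 <= (t - f) * ((w' j - w j) * p) by rewrite mulr_ge0 // subr_ge0.
  move: (_ * _) => y y0; have [l1|l1] := leP (x + y) theta; have [l2|l2] := leP x theta => //.
  by exfalso; lra.
have -> : x + (w' j - w j) * ((t - f) * p) = x - (f - t) * ((w' j - w j) * p) by ring.
have : 0 <= (f - t) * ((w' j - w j) * p) by rewrite mulr_ge0 // subr_ge0 ltW.
move: (_ * _) => y y0; have [l1|l1] := leP (x - y) theta; have [l2|l2] := leP x theta => //.
- exact: ltW.
- by exfalso; lra.
Qed.

End Energy.

(* Chebyshev's association inequality. *)
Lemma sum_antitone_le0 (R : realFieldType) (G : finType) (p v F : G -> R) :
  (forall h, 0 <= p h) -> \sum_h p h = 1 -> \sum_h p h * v h = 0 ->
  (forall h h', v h <= v h' -> F h' <= F h) -> \sum_h p h * (v h * F h) <= 0.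
Proof.
move=> p0 p1 pv anti.
(* For two independent copies [h], [h'] the product of differences is never positive, and since [v]
   has mean zero its expectation is twice the sum to be bounded. *)
have : \sum_h \sum_h' p h * p h' * ((v h - v h') * (F h - F h')) <= 0.
  apply: sumr_le0 => h _; apply: sumr_le0 => h' _.
  rewrite mulr_ge0_le0 ?mulr_ge0 //.
  have [le|/ltW le] := leP (v h) (v h').
    by rewrite mulr_le0_ge0 ?subr_le0 ?subr_ge0 ?anti.
  by rewrite mulr_ge0_le0 ?subr_le0 ?subr_ge0 ?anti.
set S := \sum_h _ * (_ * _); pose SF := \sum_h p h * F h.
have inner h : \sum_h' p h * p h' * ((v h - v h') * (F h - F h'))
    = p h * (v h * F h) + ((- SF) * (p h * v h) + S * p h).
  rewrite (eq_bigr (fun h' => (p h * (v h * F h) * p h' + (- (p h * v h)) * (p h' * F h'))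
    + ((- (p h * F h)) * (p h' * v h') + p h * (p h' * (v h' * F h'))))) => [|h' _]; last by ring.
  by rewrite !big_split /= -!mulr_sumr p1 pv -/S -/SF; ring.
under eq_bigr do rewrite inner.
by rewrite !big_split /= -!mulr_sumr p1 pv -/S; lra.
Qed.

(** * The threshold rule on independent weights *)

Section RandomWeights.
Variables (R : rcfType) (n m k l : nat) (P : 'I_m -> pauli_term n).
Hypotheses (l_gt0 : (0 < l)%N) (P_loc : forall j, (1 <= locality (P j) <= k)%N).
Hypothesis P_deg : forall q, (#|[set j | participates (P j) q]| <= l)%N.
Variables (G : finType) (p : 'I_m -> G -> R).
Hypotheses (p_ge0 : forall i g, 0 <= p i g) (p_sum : forall i, \sum_g p i g = 1).
Variables (val : 'I_m -> G -> R) (B a2 t : R).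
Hypotheses (val_mean : forall i, \sum_g p i g * val i g = 0).
Hypotheses (val_le : forall i g, `|val i g| <= B) (B_ge0 : 0 <= B).
Hypotheses (a2_ge0 : 0 <= a2) (val_sqr : forall i, a2 <= \sum_g p i g * val i g ^+ 2).

Let kappa : R := (2 / 7) ^+ k.
Let e : R := 7^-1 * kappa.
Hypotheses (t_gt0 : 0 < t) (t_le : 3 * B ^+ 4 <= 2 * (e ^+ 2 * a2) * t ^+ 2).
Let c0 : R := e ^+ 2 * a2 / (2 * t).

Definition sample_weight (x : {ffun 'I_m -> G}) (j : 'I_m) : R := val j (x j).

Let W := sample_weight.
Let E := expect p.
Let X x v := local_field P (W x) v.
Let rule theta x := threshold_rule P (W x) theta.
Let F theta x := energy P (W x) (rule theta x).

Let kappa_ge0 : 0 <= kappa. Proof. by rewrite exprn_ge0 //; lra. Qed.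

Let e_ge0 : 0 <= e. Proof. by rewrite mulr_ge0 ?invr_ge0. Qed.

Let c0_ge0 : 0 <= c0.
Proof. by rewrite divr_ge0 ?mulr_ge0 ?sqr_ge0 // ltW. Qed.

Let loc_le j : (locality (P j) <= k)%N. Proof. by case/andP: (P_loc j). Qed.

Let factor j theta x q := bloch R (P j q) (rule theta x q).

Let factor_anti j theta x q h h' : val j h <= val j h' ->
  factor j theta (set_coord x j h') q <= factor j theta (set_coord x j h) q.
Proof.
move=> le; apply: (@factor_antitone R n m P _ _ j) => [i ij|].
  by rewrite /W /sample_weight !set_coordNE.
by rewrite /W /sample_weight !set_coordE.
Qed.

(* As functions of the weight of the term, all factors are nonnegative and antitone,
   and so is the product of the factors other than the one at v minus its lower bound
   kappa. Hence association lets us replace that product by kappa. *)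
Lemma expect_term_le j theta v : participates (P j) v ->
  E (fun x => W x j * term_value R P j (rule theta x)) <=
  kappa * E (fun x => W x j * slope R P j v * (rule theta x v)%:R).
Proof.
move=> pv; rewrite -[leLHS](expect_average p_sum j) -[E _ in leRHS](expect_average p_sum j).
rewrite -expectZ; apply: le_expect => // x.
rewrite /average mulr_sumr.
set D := bloch R (P j v) true - bloch R (P j v) false.
pose A := \prod_(q | q != v) bloch R (P j q) false.
have A01 : 0 <= A <= 1 by apply: prod_bounds => q; rewrite bloch_ge0 bloch_le1.
pose b h := rule theta (set_coord x j h).
pose f h := factor j theta (set_coord x j h) v.
have fE h : f h = bloch R (P j v) false + D * (b h v)%:R.
  by rewrite /f /factor -/(b h) /D; case: (b h v) => /=; ring.
pose Gh h := \prod_(q | q != v) factor j theta (set_coord x j h) q.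
have Gk h : kappa <= Gh h by apply: prod_bloch_ge.
have f_anti h h' : val j h <= val j h' -> f h' <= f h by apply: factor_anti.
have f_ge0 h : 0 <= f h by apply: bloch_ge0.
have G_anti h h' : val j h <= val j h' -> Gh h' <= Gh h.
  by move=> le; apply: ler_prod => q _; rewrite bloch_ge0 factor_anti.
have := @sum_antitone_le0 _ _ (p j) (val j) (fun h => f h * (Gh h - kappa))
  (p_ge0 j) (p_sum j) (val_mean j).
have /[swap]/[apply] : forall h h', val j h <= val j h' ->
    f h' * (Gh h' - kappa) <= f h * (Gh h - kappa).
  by move=> h h' le; rewrite ler_pM ?subr_ge0 // ?lerD2r ?f_anti ?G_anti.
have := @sum_antitone_le0 _ _ (p j) (val j) f (p_ge0 j) (p_sum j) (val_mean j) f_anti.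
set sf := \sum_h _; set sG := \sum_h _ => sf0 sG0.
have -> : \sum_h p j h * (W (set_coord x j h) j * term_value R P j (rule theta (set_coord x j h)))
    = sG + kappa * sf.
  rewrite mulr_sumr -big_split /=; apply: eq_bigr => h _.
  rewrite /W /sample_weight set_coordE /term_value (bigD1 v) //= -/(Gh h) -/(factor j theta _ v) -/(f h).
  by ring.
(* The constant part of [f] contributes nothing because the weight is centred; only the indicator of
   a flip at [v] remains. *)
have sfE : sf = \sum_h p j h * (val j h * (D * (b h v)%:R)).
  rewrite /sf (eq_bigr (fun h => bloch R (P j v) false * (p j h * val j h)
    + p j h * (val j h * (D * (b h v)%:R)))) => [|h _]; last by rewrite fE; ring.
  by rewrite big_split /= -mulr_sumr val_mean mulr0 add0r.
have -> : \sum_h kappa * (p j h * (W (set_coord x j h) j * slope R P j v *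
    (rule theta (set_coord x j h) v)%:R)) = kappa * A * sf.
  rewrite sfE mulr_sumr; apply: eq_bigr => h _.
  by rewrite /W /sample_weight set_coordE slopeE -/(b h) -/D -/A; ring.
case/andP: A01 => A0 A1.
(* As [sf <= 0] and [A <= 1], inserting the remaining factor [A] of the slope only weakens the
   bound. *)
have : 0 <= kappa * (1 - A) * - sf by rewrite !mulr_ge0 ?subr_ge0 ?oppr_ge0.
by move=> ?; lra.
Qed.

Lemma expect_term_le0 j theta : E (fun x => W x j * term_value R P j (rule theta x)) <= 0.
Proof.
rewrite /E -(expect_average p_sum j) -(expect_cst p_sum 0); apply: le_expect => // x.
rewrite /average.
under eq_bigr do rewrite /W /sample_weight set_coordE.
apply: sum_antitone_le0 => // h h' le.
by apply: ler_prod => q _; rewrite bloch_ge0 factor_anti.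
Qed.

(** [expect_term_le] is summed over all pairs of a term and one of its qubits. A term then occurs at
    most [k] times, and since its expectation is not positive, [k] copies of it are a lower bound
    for the copies that occur. *)
Lemma expect_energy_le theta :
  k%:R * E (F theta) <= kappa * \sum_v E (fun x => X x v * (rule theta x v)%:R).
Proof.
have -> : E (F theta) = \sum_j E (fun x => W x j * term_value R P j (rule theta x)).
  by rewrite /E -expect_sum.
have -> : \sum_v E (fun x => X x v * (rule theta x v)%:R)
   = \sum_j \sum_v E (fun x => W x j * slope R P j v * (rule theta x v)%:R).
  rewrite [RHS]exchange_big /=; apply: eq_bigr => v _; rewrite /E -expect_sum.
  by apply: eq_expect => x; rewrite mulr_suml.
rewrite !mulr_sumr; apply: ler_sum => j _; rewrite [leRHS]mulr_sumr.
rewrite [leRHS](bigID (participates (P j))) /= [X in _ <= _ + X]big1 ?addr0; last first.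
  move=> v pv; rewrite /E (eq_expect (F' := fun=> 0)) ?expect_cst ?mulr0 // => x.
  by rewrite slope_eq0 // mulr0 mul0r.
apply: (@le_trans _ _ (\sum_(v | participates (P j) v)
    E (fun x => W x j * term_value R P j (rule theta x)))); last first.
  by apply: ler_sum => v pv; apply: expect_term_le.
rewrite sumr_const -[leRHS]mulr_natl -[#|_|]/(locality (P j)).
by rewrite ler_wnM2r ?expect_term_le0 // ler_nat.
Qed.

Let deg v : nat := #|[set j | participates (P j) v]|.

Let XE x v : X x v = \sum_(j <- enum [set j | participates (P j) v]) slope R P j v * val j (x j).
Proof.
rewrite big_enum /X /local_field /= (bigID (fun j => j \in [set j | participates (P j) v])) /=.
rewrite [X in _ + X = _]big1 ?addr0 => [|j]; last first.
  by rewrite inE => nj; rewrite slope_eq0 // mulr0.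
by apply: eq_bigr => j _; rewrite mulrC.
Qed.

(** Pointwise, X times the indicator of X <= theta is at most [- theta + (X - |X|) / 2]. Here X has
    mean zero, E|X| is at least [c0 * sqrt(deg v)], and [- theta] costs at most [c0 / 4], which is
    half of the gain once [deg v >= 1]. If [deg v = 0], then X vanishes. *)
Lemma expect_local_field_le theta v : - (c0 / 4) <= theta -> theta < 0 ->
  E (fun x => X x v * (rule theta x v)%:R) <= - (c0 / 4) * Num.sqrt (deg v)%:R.
Proof.
move=> t1 t0.
have [d0|d0] := posnP (deg v).
  rewrite d0 sqrtr0 mulr0 /E -(expect_cst p_sum 0); apply: le_expect => // x.
  have -> : X x v = 0; last by rewrite mul0r.
  by rewrite XE (cards0_eq d0) enum_set0 big_nil.
have Em : E (fun x => X x v) = 0.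
  rewrite /E /X /local_field expect_sum big1 // => j _.
  rewrite -(expect_average p_sum j) (eq_expect (F' := fun=> 0)) ?expect_cst // => x.
  transitivity (slope R P j v * \sum_g p j g * val j g); last by rewrite val_mean mulr0.
  rewrite /average mulr_sumr.
  by apply: eq_bigr => h _; rewrite /W /sample_weight set_coordE; ring.
have En : c0 * Num.sqrt (deg v)%:R <= E (fun x => `|X x v|).
  have := @expect_norm_ge R _ G p p_ge0 p_sum val B a2 val_mean val_le val_sqr
    (fun j => slope R P j v) e e_ge0 (fun j => slope_le1 R P j v)
    (enum [set j | participates (P j) v]) t (enum_uniq _).
  rewrite -cardE -/(deg v) -/c0 => /(_ _ a2_ge0 t_gt0 t_le) le.
  rewrite /E (eq_expect (fun x => congr1 Num.norm (XE x v))); apply: le => j.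
  rewrite mem_enum inE => pj; apply: slope_ge => //.
have sq1 : 1 <= Num.sqrt (deg v)%:R :> R by rewrite -{1}sqrtr1 ler_sqrt ?ler1n ?ler0n.
apply: (@le_trans _ _ (E (fun x => - theta + (2^-1 * X x v + (- 2^-1) * `|X x v|)))).
  apply: le_expect => // x; rewrite /rule /threshold_rule -/(X x v).
  by case: (leP (X x v) theta) => le; case: (ler0P (X x v)) => le'; rewrite ?mulr1 ?mulr0; lra.
rewrite /E !expectD !expectZ expect_cst // -!/(E _) Em mulr0 add0r.
have : c0 * 1 <= c0 * Num.sqrt (deg v)%:R by rewrite ler_wpM2l.
have -> : - (c0 / 4) * Num.sqrt (deg v)%:R = - (c0 * Num.sqrt (deg v)%:R) / 4 by field.
move: En; set s := c0 * Num.sqrt _; lra.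
Qed.

(** Since [deg v <= l], each degree is at most [sqrt(deg v) * sqrt l], and the degrees add up to at
    least [m] because every term acts on some qubit. *)
Lemma sum_sqrt_deg_ge : m%:R / Num.sqrt l%:R <= \sum_v Num.sqrt (deg v)%:R :> R.
Proof.
have l0 : 0 < Num.sqrt l%:R :> R by rewrite sqrtr_gt0 ltr0n.
rewrite ler_pdivrMr // mulr_suml.
apply: (@le_trans _ _ (\sum_v (deg v)%:R)); last first.
  apply: ler_sum => v _; rewrite -{1}[(deg v)%:R]sqr_sqrtr ?ler0n // expr2.
  by rewrite ler_wpM2l ?sqrtr_ge0 // ler_wsqrtr // ler_nat P_deg.
rewrite -natr_sum ler_nat /deg.
under eq_bigr do rewrite -sum1dep_card.
rewrite (exchange_big_dep xpredT) //= -[X in (X <= _)%N](card_ord m) -sum1_card.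
by apply: leq_sum => j _; rewrite sum1_card; case/andP: (P_loc j).
Qed.

Hypothesis k_gt0 : (0 < k)%N.
Let c1 : R := kappa * c0 / (4 * k%:R).

Lemma expect_energy_threshold theta : - (c0 / 4) <= theta -> theta < 0 ->
  E (F theta) <= - (c1 * (m%:R / Num.sqrt l%:R)).
Proof.
move=> t1 t0.
have k0 : 0 < k%:R :> R by rewrite ltr0n.
rewrite -(ler_pM2l k0) (le_trans (expect_energy_le theta)) //.
have -> : k%:R * - (c1 * (m%:R / Num.sqrt l%:R)) = kappa * (- (c0 / 4) * (m%:R / Num.sqrt l%:R)).
  have s0 : Num.sqrt l%:R != 0 :> R by rewrite sqrtr_eq0 -ltNge ltr0n.
  by rewrite /c1; field; rewrite s0 gt_eqF.
rewrite ler_wpM2l //.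
apply: (@le_trans _ _ (\sum_v - (c0 / 4) * Num.sqrt (deg v)%:R)).
  by apply: ler_sum => v _; apply: expect_local_field_le.
rewrite -mulr_sumr ler_wnM2l ?sum_sqrt_deg_ge //.
by rewrite oppr_le0 divr_ge0.
Qed.

(** One weight enters X_v only for the qubits [v] of its own term. Hence only terms sharing a qubit
    with that term can change, each by at most [2 * B], and counting the shared qubits shows that
    there are at most [k * l] of them. *)
Lemma energy_oscillates theta i : oscillates i (2 * B * (k * l)%:R) (F theta).
Proof.
move=> x h; rewrite /F /energy -sumrB (le_trans (ler_norm_sum _ _ _)) //.
set x' := set_coord x i h.
have term_le y j : `|W y j * term_value R P j (rule theta y)| <= B.
  have /andP[f0 f1] := @term_value_bounds R n m P j (rule theta y).
  rewrite normrM [X in _ * X]ger0_norm // -[leRHS]mulr1; apply: ler_pM => //.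
  exact: val_le.
pose shared j : nat := (\sum_(v | participates (P i) v) participates (P j) v)%N.
have le_j j : `|W x' j * term_value R P j (rule theta x')
    - W x j * term_value R P j (rule theta x)| <= 2 * B * (shared j)%:R.
  have [s0|s0] := posnP (shared j); last first.
    apply: (@le_trans _ _ (2 * B)).
      by rewrite (le_trans (ler_normB _ _)) // mulr_natl mulr2n lerD.
    by rewrite -[leLHS]mulr1 ler_wpM2l ?mulr_ge0 // ler1n.
  have disj v : participates (P j) v -> ~~ participates (P i) v.
    move=> pj; apply/negP => pi; move/eqP: s0; rewrite /shared sum_nat_eq0.
    by move=> /forallP/(_ v); rewrite pi pj.
  (* Term [i] shares a qubit with itself, as it is not the identity. *)
  have ij : j != i.
    apply/eqP => ji; have /andP[/card_gt0P[v]] := P_loc i.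
    by rewrite unfold_in => pv; move: (disj v); rewrite ji => d; case/negP: (d pv).
  have -> : W x' j = W x j by rewrite /W /sample_weight set_coordNE.
  rewrite (@eq_term_value R n m P j (rule theta x') (rule theta x)) ?subrr ?normr0 => [|v].
    by rewrite !mulr_ge0.
  rewrite unfold_in => /disj pv; rewrite /rule /threshold_rule; congr (_ <= _).
  apply: eq_bigr => j' _; have [->|j'i] := eqVneq j' i; first by rewrite slope_eq0 ?mulr0.
  by rewrite /W /sample_weight set_coordNE.
apply: (le_trans (ler_sum _ (fun j _ => le_j j))).
rewrite -mulr_sumr ler_wpM2l ?mulr_ge0 // -natr_sum ler_nat /shared exchange_big /=.
apply: (@leq_trans (\sum_(v | participates (P i) v) l)%N).
  apply: leq_sum => v _; apply: leq_trans (P_deg v).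
  rewrite -sum1dep_card [leqRHS]big_mkcond; apply: leq_sum => j _.
  by case: ifP => // ->.
by rewrite sum_nat_const leq_mul2r loc_le orbT.
Qed.

Variables (M : nat) (theta : 'I_M -> R).
Hypotheses (M_gt0 : (0 < M)%N) (theta_ge : forall s, - (c0 / 4) <= theta s).
Hypothesis theta_lt0 : forall s, theta s < 0.

(** At a single threshold a small perturbation may flip many qubits at once; the mean over the
    thresholds is the quantity that can be controlled. *)
Definition mean_energy (w : 'I_m -> R) : R :=
  M%:R^-1 * \sum_s energy P w (threshold_rule P w (theta s)).

Let Fbar x := mean_energy (W x).

Lemma mean_energy_oscillates i : oscillates i (2 * B * (k * l)%:R) Fbar.
Proof.
move=> x h; have M0 : 0 < M%:R :> R by rewrite ltr0n.
rewrite /Fbar /mean_energy -mulrBr -sumrB normrM [`|M%:R^-1|]ger0_norm ?invr_ge0 ?ler0n //.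
rewrite ler_pdivrMl //.
apply: (le_trans (ler_norm_sum _ _ _)).
apply: (@le_trans _ _ (\sum_(s < M) 2 * B * (k * l)%:R)).
  by apply: ler_sum => s _; apply: energy_oscillates.
by rewrite sumr_const card_ord -[leLHS]mulr_natl.
Qed.

Lemma expect_mean_energy : E Fbar <= - (c1 * (m%:R / Num.sqrt l%:R)).
Proof.
have M0 : 0 < M%:R :> R by rewrite ltr0n.
rewrite /E /Fbar /mean_energy expectZ expect_sum ler_pdivrMl //.
apply: (@le_trans _ _ (\sum_(s < M) - (c1 * (m%:R / Num.sqrt l%:R)))).
  by apply: ler_sum => s _; apply: expect_energy_threshold.
by rewrite sumr_const card_ord -[leLHS]mulr_natl.
Qed.

Lemma mean_energy_deviation (r : R) : r = c1 * (m%:R / Num.sqrt l%:R) -> 0 < r ->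
  \sum_(x | - (r / 2) < Fbar x) weight p x
    <= m%:R * (2 * B * (k * l)%:R) ^+ 2 / (r / 2) ^+ 2.
Proof.
move=> rE r0.
have := chebyshev_le p_ge0 p_sum (divr_gt0 r0 (ltr0Sn R 1)) mean_energy_oscillates.
rewrite sumr_const card_ord -[_ *+ m]mulr_natl; apply: le_trans.
rewrite [leLHS]big_mkcond [leRHS]big_mkcond; apply: ler_sum => x _.
have := expect_mean_energy; rewrite -rE -/E => Er.
case: ifP => lt; last by case: ifP => // _; apply: weight_ge0.
by rewrite ifT //; lra.
Qed.

End RandomWeights.

(** * Stability of the threshold rule under perturbed weights *)

Section Stability.
Variables (R : rcfType) (n m k l : nat) (P : 'I_m -> pauli_term n).
Hypotheses (P_loc : forall j, (locality (P j) <= k)%N).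
Hypothesis P_deg : forall q, (#|[set j | participates (P j) q]| <= l)%N.

Lemma eq_energy (w : 'I_m -> R) b b' : b =1 b' -> energy P w b = energy P w b'.
Proof.
move=> e; apply: eq_bigr => j _; congr (_ * _); apply: eq_bigr => q _.
by rewrite e.
Qed.

Lemma term_value_dist j b b' : `|term_value R P j b - term_value R P j b'| <=
  (\sum_(v | participates (P j) v) (b v != b' v))%:R.
Proof.
have [e|] := boolP [forall v, participates (P j) v ==> (b v == b' v)].
  rewrite (@eq_term_value _ _ _ _ _ _ b') ?subrr ?normr0 // => v pv.
  by move/forallP: e => /(_ v)/implyP/(_ pv)/eqP.
rewrite negb_forall => /existsP[v]; rewrite negb_imply => /andP[pv bv].
apply: (@le_trans _ _ 1).
  have /andP[? ?] := @term_value_bounds R n m P j b.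
  have /andP[? ?] := @term_value_bounds R n m P j b'.
  by rewrite ler_norml; lra.
by rewrite ler1n lt0n sum_nat_eq0; apply/forallPn; exists v; rewrite pv bv.
Qed.

Lemma local_field_dist (w w' : 'I_m -> R) d v : 0 <= d ->
  (forall j, `|w j - w' j| <= d) -> `|local_field P w v - local_field P w' v| <= l%:R * d.
Proof.
move=> d0 dw; rewrite /local_field -sumrB.
apply: (le_trans (ler_norm_sum _ _ _)).
apply: (@le_trans _ _ (\sum_(j | participates (P j) v) d)).
  rewrite [leRHS]big_mkcond; apply: ler_sum => j _; rewrite -mulrBl normrM.
  case: ifP => pj; last by rewrite slope_eq0 ?pj // normr0 mulr0.
  by rewrite -[leRHS]mulr1 ler_pM // slope_le1.
rewrite sumr_const -[leLHS]mulr_natl ler_wpM2r // ler_nat.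
by apply: leq_trans (P_deg v); rewrite cardsE.
Qed.

Variables (M : nat) (theta : 'I_M -> R) (d B : R).
Hypotheses (M_gt0 : (0 < M)%N) (d_ge0 : 0 <= d) (B_ge0 : 0 <= B).
Hypothesis theta_far : forall s s', s != s' -> 2 * (l%:R * d) < `|theta s - theta s'|.

Let rule w s := threshold_rule P w (theta s).

(* The thresholds are so far apart that the perturbation can carry the local field
   of a qubit across at most one of them. *)
Lemma flips_le1 (w w' : 'I_m -> R) v : (forall j, `|w j - w' j| <= d) ->
  (\sum_s (rule w s v != rule w' s v) <= 1)%N.
Proof.
move=> dw.
have near s : rule w s v != rule w' s v -> `|local_field P w v - theta s| <= l%:R * d.
  have := local_field_dist v d_ge0 dw.
  rewrite /rule /threshold_rule !ler_norml => /andP[le1 le2].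
  have [h1|h1] := leP (local_field P w v) _; have [h2|h2] := leP (local_field P w' v) _ => //= _.
    by apply/andP; split; lra.
  by apply/andP; split; lra.
have [s sP|no] := pickP (fun s => rule w s v != rule w' s v); last first.
  by rewrite big1 // => s _; rewrite no.
rewrite (bigD1 s) //= big1 ?addn0 ?leq_b1 // => s' ss'.
apply/eqP; rewrite eqb0; apply/negP => s'P.
have := theta_far ss'; have := near _ sP; have := near _ s'P.
rewrite !ler_norml => /andP[? ?] /andP[? ?]; rewrite ltNge => /negP; apply.
by rewrite ler_norml; apply/andP; split; lra.
Qed.

(** Some threshold does at least as well as the average. For fixed flips, changing the weights costs
    at most [d] per term, because term values lie in [0, 1]. Changed flips cost at most [B] for each
    pair of a term and one of its flipped qubits; each of the at most [k * m] pairs is hit at no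
    more than one of the [M] thresholds, hence the division by [M]. *)
Lemma threshold_stable (w w' : 'I_m -> R) (r : R) :
  (forall j, `|w j| <= B) -> (forall j, `|w j - w' j| <= d) ->
  mean_energy P theta w <= r ->
  exists s, energy P w' (rule w' s) <= r + (d * m%:R + B * (k * m)%:R / M%:R).
Proof.
move=> wB dw le_r.
apply: contrapT => /forallNP no.
have M0 : 0 < M%:R :> R by rewrite ltr0n.
have lt_s s : r + (d * m%:R + B * (k * m)%:R / M%:R) < energy P w' (rule w' s).
  by rewrite ltNge; apply/negP; apply: no.
have : \sum_(s < M) (r + (d * m%:R + B * (k * m)%:R / M%:R)) < \sum_s energy P w' (rule w' s).
  by apply: ltr_sum => //; apply/hasP; exists (Ordinal M_gt0) => //.
rewrite sumr_const card_ord -[ltLHS]mulr_natl; apply/negP; rewrite -leNgt.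
have le_E s : energy P w' (rule w' s) <= energy P w (rule w s) +
   (d * m%:R + B * (\sum_j \sum_(v | participates (P j) v) (rule w s v != rule w' s v))%:R).
  have -> : d * m%:R = \sum_(j < m) d by rewrite sumr_const card_ord mulr_natr.
  rewrite natr_sum mulr_sumr -!big_split; apply: ler_sum => j _ /=.
  have t1 := term_value_dist j (rule w s) (rule w' s).
  have /andP[f0 f1] := @term_value_bounds R n m P j (rule w' s).
  set f := term_value _ _ _ (rule w s) in t1 *; set f' := term_value _ _ _ (rule w' s) in t1 f0 f1 *.
  have -> : w' j * f' = w j * f + ((w' j - w j) * f' - w j * (f - f')) by ring.
  rewrite lerD2l lerD //.
    by rewrite (le_trans (ler_norm _)) // normrM distrC [`|f'|]ger0_norm // -[leRHS]mulr1 ler_pM.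
  by rewrite (le_trans (ler_norm _)) // normrN normrM ler_pM.
apply: (le_trans (ler_sum _ (fun s _ => le_E s))); rewrite !big_split /=.
rewrite sumr_const card_ord -[_ *+ M]mulr_natl mulrDr.
apply: lerD; first by rewrite mulrC -ler_pdivrMr // mulrC.
rewrite mulrDr; apply: lerD => //.
rewrite [leRHS](_ : _ = B * (k * m)%:R); last by field; rewrite gt_eqF.
rewrite -mulr_sumr ler_wpM2l // -natr_sum ler_nat exchange_big /=.
rewrite -[X in (_ <= _ * X)%N]card_ord mulnC -sum_nat_const; apply: leq_sum => j _.
rewrite exchange_big /=; apply: (@leq_trans (\sum_(v | participates (P j) v) 1)%N).
  by apply: leq_sum => v _; apply: flips_le1.
by rewrite sum1_card; apply: P_loc.
Qed.

End Stability.

(** * Finitely many candidates replace all thresholds *)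

Section Candidates.
Variables (R : rcfType) (n m : nat) (P : 'I_m -> pauli_term n) (w : 'I_m -> R).

(** With [u] a natural number, [u = n] stands for no flip at all; as a candidate it is the threshold
    just below 0. *)
Definition single (u : nat) (q : 'I_n) : bool := q == u :> nat.
Definition candidate (u : nat) (v : 'I_n) : bool :=
  energy P w (single v) < energy P w (single u).

(** Among the values X_u above [theta], including the value 0 at [u = n], take the smallest: no X_v
    lies strictly between, so X_v <= theta is equivalent to X_v < X_u. *)
Lemma threshold_candidate theta : theta < 0 ->
  exists2 u : nat, (u <= n)%N & threshold_rule P w theta =1 candidate u.
Proof.
move=> t0; pose x (u : 'I_n.+1) := energy P w (single u) - energy P w pred0.
have xv (v : 'I_n) : local_field P w v = x (widen_ord (leqnSn n) v).
  by rewrite local_fieldE /x.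
have x0 : theta < x ord_max.
  have -> : x ord_max = 0; last by [].
  apply/eqP; rewrite subr_eq0; apply/eqP; apply: eq_energy => q.
  by rewrite /single /= ltn_eqF.
case: (@Order.TotalTheory.arg_minP _ _ _ ord_max (fun u => theta < x u) x x0) => u tu u_min.
exists u; first by rewrite -ltnS.
move=> v; rewrite /threshold_rule /candidate xv.
have -> : (energy P w (single v) < energy P w (single u)) =
  (x (widen_ord (leqnSn n) v) < x u) by rewrite /x ltrD2r.
apply/idP/idP => [le|lt]; first exact: le_lt_trans tu.
by rewrite leNgt; apply/negP => /u_min; rewrite leNgt lt.
Qed.

End Candidates.

(** * Discretization of the weights *)

Section Grid.
Local Open Scope classical_set_scope.
Local Open Scope ring_scope.
Variables (R : realType) (a b gamma : R).
Hypotheses (a_gt0 : 0 < a) (ab : a <= b) (gamma_gt0 : 0 < gamma).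

(** The cells are half-open, and the successor makes the last one contain the endpoint [b]. *)
Definition grid_size : nat := (Num.trunc (2 * b / gamma)).+1.
Definition grid_point (g : nat) : R := - b + g%:R * gamma.
Definition grid_cell (g : nat) : set R :=
  `[grid_point g, grid_point g.+1[%classic.

Let b_ge0 : 0 <= b. Proof. exact: ltW (lt_le_trans a_gt0 ab). Qed.

Lemma grid_pointS g : grid_point g.+1 = grid_point g + gamma.
Proof. by rewrite /grid_point -natr1; ring. Qed.

Lemma grid_point_norm (g : 'I_grid_size) : `|grid_point g| <= b.
Proof.
have bg : 0 <= 2 * b / gamma by rewrite divr_ge0 ?mulr_ge0 // ltW.
have : (g%:R : R) <= 2 * b / gamma.
  apply: (@le_trans _ _ (Num.trunc (2 * b / gamma))%:R).
    by rewrite ler_nat -ltnS.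
  by rewrite truncn_le.
rewrite ler_pdivlMr // /grid_point => le.
have : 0 <= g%:R * gamma by rewrite mulr_ge0 // ltW.
by rewrite ler_norml => ?; apply/andP; split; lra.
Qed.

Lemma grid_cellP g y : grid_cell g y -> grid_point g <= y < grid_point g + gamma.
Proof. by rewrite -grid_pointS /grid_cell /= in_itv. Qed.

Lemma grid_cover y : `|y| <= b -> exists g : 'I_grid_size, grid_cell g y.
Proof.
rewrite ler_norml => /andP[y1 y2].
have y0 : 0 <= (y + b) / gamma by rewrite divr_ge0 ?(ltW gamma_gt0) //; lra.
have /andP[t1 t2] := Num.Theory.truncn_itv y0.
have lt : (Num.trunc ((y + b) / gamma) < grid_size)%N.
  rewrite /grid_size ltnS; apply: le_truncn.
  by rewrite ler_pM2r ?invr_gt0 //; lra.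
exists (Ordinal lt); rewrite /grid_cell /= in_itv /= /grid_point.
move: t1 t2; rewrite ler_pdivlMr // ltr_pdivrMr // => ? ?.
by apply/andP; split; lra.
Qed.

Lemma grid_cell_inj (g g' : nat) y : grid_cell g y -> grid_cell g' y -> g = g'.
Proof.
wlog lt : g g' / (g < g')%N.
  move=> wl; case: (ltngtP g g') => // lt gy g'y; first exact: wl gy g'y.
  by apply/esym; apply: wl g'y gy.
move=> /grid_cellP/andP[_ lt1] /grid_cellP/andP[le2 _]; exfalso.
suff : grid_point g + gamma <= grid_point g' by lra.
rewrite -grid_pointS /grid_point lerD2l ler_wpM2r ?(ltW gamma_gt0) //.
by rewrite ler_nat.
Qed.

Lemma measurable_grid_cell g : measurable (grid_cell g).
Proof. exact: measurable_itv. Qed.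

Variables (d : measure_display) (T : measurableType d) (mu : probability T R).
Variable X : {RV mu >-> R}.
Hypotheses (X_mean : ('E_mu[X])%E = 0%E).
Hypothesis X_bound : mu [set om | (a <= `|X om| <= b)%R]%classic = 1%E.

Let A (g : nat) : set T := X @^-1` grid_cell g.
Let D : set T := [set om | (a <= `|X om| <= b)%R]%classic.

Lemma measurable_grid g : measurable (A g).
Proof. exact: (measurable_funPTI X (measurable_grid_cell g)). Qed.

Let mD : measurable D.
Proof.
have a0 := a_gt0.
have -> : D = X @^-1` (`[a, b] `|` `[- b, - a])%classic.
  apply/seteqP; split => om; rewrite /D /= !in_itv /=.
    by case: (ler0P (X om)) => X0 /andP[? ?]; [right | left]; apply/andP; split; lra.
  by case=> /andP[? ?]; case: (ler0P (X om)) => X0; apply/andP; split; lra.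
by apply: measurable_funPTI; apply: measurableU; exact: measurable_itv.
Qed.

Definition grid_prob (g : nat) : R := fine (mu (A g)).

Lemma grid_prob_ge0 g : 0 <= grid_prob g.
Proof. by rewrite fine_ge0. Qed.

Lemma grid_probE g : mu (A g) = (grid_prob g)%:E.
Proof. by rewrite fineK // fin_num_measure //; exact: measurable_grid. Qed.

Let tA : trivIset [set: 'I_grid_size] (fun g : 'I_grid_size => A g).
Proof.
apply/trivIsetP => g g' _ _ gg'; apply/seteqP; split => // om [/= Ag Ag'].
by move/eqP: gg'; apply; apply/val_inj; apply: grid_cell_inj Ag Ag'.
Qed.

Lemma grid_prob_sum : \sum_(g < grid_size) grid_prob g = 1.
Proof.
apply: EFin_inj; rewrite -sumEFin.
under eq_bigr do rewrite -grid_probE.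
rewrite -(@measure_bigsetU_ord _ _ _ mu grid_size xpredT (fun g => A g)) //; last first.
  by move=> g; exact: measurable_grid.
apply/eqP; rewrite eq_le; apply/andP; split.
  by apply: probability_le1; apply: bigsetU_measurable => g _; exact: measurable_grid.
rewrite -X_bound; apply: le_measure; rewrite ?inE //.
  by apply: bigsetU_measurable => g _; exact: measurable_grid.
move=> om /andP[_ /grid_cover[g Ag]].
by rewrite -bigcup_mkord; exists g => //=.
Qed.

Let muDC : mu (~` D) = 0%E.
Proof. by rewrite probability_setC // X_bound subee. Qed.

Let grid_probD g : mu (A g `&` D) = (grid_prob g)%:E.
Proof.
rewrite -grid_probE [in RHS](_ : A g = (A g `&` D) `|` (A g `&` ~` D)); last first.
  by rewrite -setIUr setUv setIT.
have mA := measurable_grid g.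
rewrite measureU0 //; [exact: measurableI | by apply: measurableI => //; exact: measurableC |].
have mDC := measurableC mD.
by apply: (subset_measure0 _ _ _ muDC) => //; exact: measurableI.
Qed.

(** A cell of nonzero probability must meet the almost sure event [D], and so it contains a value of
    modulus at least [a]. *)
Lemma grid_prob_neq0 g : grid_prob g != 0 -> a - gamma <= `|grid_point g|.
Proof.
move=> p0; have [om [/grid_cellP/andP[X1 X2] /andP[X3 _]]] : exists om, (A g `&` D) om.
  apply/set0P; apply: contra_neqN p0 => /eqP AD0.
  by apply: EFin_inj; rewrite -grid_probD AD0 measure0.
have := ler_normB (X om) (X om - grid_point g).
have -> : X om - (X om - grid_point g) = grid_point g by ring.
have /ler_normlP[? ?] : `|X om - grid_point g| <= gamma by rewrite ler_norml; apply/andP; split; lra.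
have := ler_distD (grid_point g) (X om) 0; rewrite !subr0.
have : `|X om - grid_point g| <= gamma by rewrite ler_norml; apply/andP; split; lra.
lra.
Qed.

(** The rounded variable is a simple function [s] within [gamma] of [f], which is [X] cut off to the
    almost sure event [D]. The cut-off makes the integrand bounded, hence integrable, and keeps the
    integral 0. *)
Lemma grid_mean : `|\sum_(g < grid_size) grid_prob g * grid_point g| <= gamma.
Proof.
pose f om : R := X om * \1_D om.
pose s om : R := \sum_(g < grid_size) grid_point g * \1_(A g `&` D) om.
have mAD (g : nat) : measurable (A g `&` D) by apply: measurableI => //; exact: measurable_grid.
have mf : measurable_fun setT f.
  by apply: measurable_funM; [exact: measurable_funPT | exact: measurable_indic].
have intf : mu.-integrable setT (EFin \o f).
  apply: measurable_bounded_integrable => //; first by apply: (@le_lt_trans _ _ 1%E); [exact: probability_le1 | exact: ltry].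
  exists b; split; first exact: num_real.
  move=> M bM om _ /=; apply: le_trans (ltW bM).
  rewrite /f indicE; case: (boolP (om \in D)) => [|_]; last by rewrite mulr0 normr0.
  by rewrite inE mulr1 => /andP[].
have If : (\int[mu]_om (f om)%:E = 0)%E.
  rewrite -X_mean expectation_def; apply: ae_eq_integral => //.
  - exact/measurable_EFinP.
  - by apply/measurable_EFinP; exact: measurable_funPT.
  exists (~` D); split => //; first exact: measurableC.
  move=> om /= nE DX; apply: nE => _.
  by rewrite /f indicE mem_set // mulr1.
have ints : mu.-integrable setT (EFin \o s).
  rewrite (_ : EFin \o s = fun om => \sum_(g < grid_size)
     (grid_point g)%:E * (\1_(A g `&` D) om)%:E)%E; last first.
    by apply/funext => om /=; rewrite /s -sumEFin.
  apply: integrable_sum => // g _; apply: integrableZl => //.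
  exact: integrable_indic.
have Is : (\int[mu]_om (s om)%:E = (\sum_(g < grid_size) grid_prob g * grid_point g)%:E)%E.
  under eq_integral do rewrite /s -sumEFin.
  rewrite integral_sum //; last first.
    by move=> g; under eq_fun do rewrite EFinM; apply: integrableZl => //; exact: integrable_indic.
  rewrite -sumEFin; apply: eq_bigr => g _.
  under eq_integral do rewrite EFinM.
  rewrite integralZl //; last exact: integrable_indic.
  by rewrite integral_indic // setIT [X in (_ * X)%E](grid_probD g) -EFinM mulrC.
have sf om : `|s om - f om| <= gamma.
  have [Dom|nD] := boolP (om \in D); last first.
    rewrite /f /s indicE (negbTE nD) mulr0 subr0 big1 ?normr0 ?ltW // => g _.
    by rewrite indicE in_setI (negbTE nD) andbF mulr0.
  have /andP[_ /grid_cover[g Ag]] : D om by rewrite inE in Dom.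
  rewrite /f /s indicE Dom mulr1 (bigD1 g) //= big1 => [|g' gg'].
    rewrite indicE in_setI Dom andbT mem_set // mulr1 addr0.
    by move/grid_cellP/andP: Ag => [? ?]; rewrite ler_norml; apply/andP; split; lra.
  rewrite indicE in_setI; case: (boolP (om \in A g')) => [|_]; last by rewrite mulr0.
  rewrite inE => Ag'; case/eqP: gg'; apply/val_inj; exact: grid_cell_inj Ag' Ag.
have msf : measurable_fun setT (fun om => (s om)%:E - (f om)%:E)%E.
  by apply: emeasurable_funB; apply/measurable_int; eassumption.
rewrite -lee_fin -[leLHS]/(`|(_ : R)%:E|%E) -Is -[X in `|X|%E]sube0 -If -integralB_EFin //.
apply: (le_trans (le_abse_integral _ _ _)) => //.
apply: (le_trans (integral_le_bound gamma%:E _ _ _ _)) => //.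
- by rewrite lee_fin ltW.
- by apply: aeW => om _; rewrite -EFinB lee_fin; exact: sf.
by rewrite [X in (_ * X)%E](@probability_setT _ _ _ mu) mule1.
Qed.

(** Rounding may shift the mean by up to [gamma]. The shift is subtracted, because the association
    inequality and the moment computations need mean exactly zero. *)
Definition grid_mu : R := \sum_(g < grid_size) grid_prob g * grid_point g.
Definition grid_value (g : nat) : R := grid_point g - grid_mu.

Lemma grid_value_mean : \sum_(g < grid_size) grid_prob g * grid_value g = 0.
Proof.
under eq_bigr do rewrite mulrBr.
by rewrite sumrB -mulr_suml grid_prob_sum mul1r subrr.
Qed.

Lemma grid_value_norm (g : 'I_grid_size) : `|grid_value g| <= b + gamma.
Proof. by rewrite (le_trans (ler_normB _ _)) // lerD ?grid_point_norm ?grid_mean. Qed.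

Lemma grid_value_sqr : 2 * gamma <= a ->
  (a - 2 * gamma) ^+ 2 <= \sum_(g < grid_size) grid_prob g * grid_value g ^+ 2.
Proof.
move=> ga; rewrite -[leLHS]mul1r -[X in X * _ <= _]grid_prob_sum mulr_suml; apply: ler_sum => g _.
have [->|p0] := eqVneq (grid_prob g) 0; first by rewrite !mul0r.
rewrite ler_wpM2l ?grid_prob_ge0 // -[leRHS]real_normK ?num_real //.
rewrite ler_sqr ?nnegrE ?normr_ge0 ?subr_ge0 //.
have := lerB_dist (grid_point g) grid_mu; rewrite -/(grid_value g).
have := grid_prob_neq0 p0; have := grid_mean; rewrite -/grid_mu => h1 h2 h3; lra.
Qed.

Lemma grid_value_dist g om : A g om -> `|X om - grid_value g| <= 2 * gamma.
Proof.
move=> /grid_cellP/andP[? ?]; have := grid_mean; rewrite -/grid_mu /grid_value.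
by rewrite !ler_norml => /andP[? ?]; apply/andP; split; lra.
Qed.

End Grid.

Lemma measure_disjoint_seq (d : measure_display) (T : measurableType d) (R : realType)
    (mu : {measure set T -> \bar R}) (I : choiceType) (s : seq I) (Q : pred I) (F : I -> set T) :
  uniq s -> (forall i, measurable (F i)) ->
  (forall i j om, F i om -> F j om -> i = j) ->
  mu (\big[setU/set0]_(i <- s | Q i) F i)%classic = (\sum_(i <- s | Q i) mu (F i))%E.
Proof.
move=> us mF disj; elim: s us => [_|i s IH /= /andP[ni us]]; first by rewrite !big_nil measure0.
rewrite !big_cons; case: ifP => Qi; last exact: IH.
rewrite measureU //; [by congr (_ + _)%E; exact: IH | exact: bigsetU_measurable |].
apply/seteqP; split => // om [Fi]; rewrite -bigcup_seq_cond => -[j /= /andP[js _] Fj].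
by move: ni; rewrite (disj _ _ _ Fi Fj) js.
Qed.

(** This carries a bound from the finite product space over to [mu]. The event is the union of the
    product cells with good index; by independence each cell has its product weight as measure, and
    the cells exhaust the probability. *)
Lemma grid_event (R : realType) (a b gamma : R) (d : measure_display) (T : measurableType d)
    (mu : probability T R) (m : nat) (w : 'I_m -> {RV mu >-> R})
    (bad : pred {ffun 'I_m -> 'I_(grid_size b gamma)}) (eps : R) :
  0 < a -> 0 < gamma -> independent_RVs w ->
  (forall j, mu [set om | (a <= `|w j om| <= b)%R]%classic = 1%E) ->
  \sum_(x | bad x) weight (fun j (g : 'I_(grid_size b gamma)) => grid_prob b gamma (w j) g) x <= eps ->
  exists E : set T, [/\ measurable E, ((1 - eps)%:E <= mu E)%E &
    forall om, E om -> exists2 x, ~~ bad x &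
      forall j, grid_cell b gamma (x j) (w j om)].
Proof.
move=> a0 g0 ind wb le_eps.
pose cell (x : {ffun 'I_m -> 'I_(grid_size b gamma)}) : set T := (\bigcap_(j in [set` [set: 'I_m]%SET]) (w j @^-1` grid_cell b gamma (x j)))%classic.
pose E : set T := (\big[setU/set0]_(x <- enum {ffun 'I_m -> 'I_(grid_size b gamma)} | ~~ bad x) cell x)%classic.
have mcell x : measurable (cell x).
  apply: fin_bigcap_measurable => [|j _]; first exact: finite_finpred.
  exact: (measurable_funPTI (w j) (measurable_grid_cell _ _ _)).
exists E; split; first exact: bigsetU_measurable.
  rewrite /E measure_disjoint_seq ?enum_uniq //; last first.
    move=> x y om xo yo; apply/ffunP => j; apply/val_inj.
    apply: (@grid_cell_inj _ b gamma g0 (x j) (y j) (w j om)).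
      by apply: xo; rewrite /= inE.
    by apply: yo; rewrite /= inE.
  have muc x : mu (cell x) = (weight (fun j (g : 'I_(grid_size b gamma)) => grid_prob b gamma (w j) g) x)%:E.
    rewrite /cell ind; last by move=> j; exact: measurable_grid_cell.
    rewrite /weight -prodEFin; rewrite (eq_bigl xpredT) => [|j]; last by rewrite inE.
    by apply: eq_bigr => j _; rewrite [LHS]grid_probE.
  rewrite (eq_bigr _ (fun x _ => muc x)).
  rewrite sumEFin lee_fin big_enum_cond /=.
  have := weight_sum (fun j => grid_prob_sum a0 g0 (wb j)).
  by rewrite (bigID bad) /=; lra.
move=> om; rewrite /E -bigcup_seq_cond => -[x /= /andP[_ nb] cx].
by exists x => // j; apply: (cx j); rewrite /= inE.
Qed.

(** Quantifying over [w'] serves two uses: [w'] equal to the true weights gives the eigenvalue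
    bound, and [w'] equal to the encoded weights concerns the algorithm. Since
    [delta <= c / sqrt l], returning from [w'] to the true weights costs at most half of the gain
    [2 * c * m / sqrt l]. *)
Lemma random_weights_candidate (R : realType) (k : nat) (a b : R) :
  (1 <= k)%N -> 0 < a -> a <= b ->
  exists2 c : R, 0 < c & forall l : nat, (1 <= l)%N ->
  exists2 delta : R, 0 < delta <= c / Num.sqrt l%:R & forall eps : R, 0 < eps ->
  exists m0 : nat, forall (m n : nat) (P : 'I_m -> pauli_term n)
    (d : measure_display) (T : measurableType d) (mu : probability T R)
    (w : 'I_m -> {RV mu >-> R}),
  (m0 <= m)%N ->
  (forall j : 'I_m, (1 <= locality (P j) <= k)%N) ->
  (forall q : 'I_n, (#|[set j : 'I_m | participates (P j) q]| <= l)%N) ->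
  independent_RVs w ->
  (forall j : 'I_m, ('E_mu[w j])%E = 0%E) ->
  (forall j : 'I_m, mu [set om | (a <= `|w j om| <= b)%R]%classic = 1%E) ->
  (0 < m)%N /\
  exists E : set T,
  [/\ measurable E, ((1 - eps)%:E <= mu E)%E &
  forall om : T, E om -> forall w' : 'I_m -> R, (forall j, `|w' j - w j om| <= delta) ->
    exists2 u : nat, (u <= n)%N &
      energy P w' (candidate P w' u) <= - (2 * c * m%:R / Num.sqrt l%:R)].
Proof.
move=> k1 a0 ab.
have b0 : 0 < b := lt_le_trans a0 ab.
pose B : R := 2 * b; pose a2 : R := (a / 2) ^+ 2.
pose kappa : R := (2 / 7) ^+ k; pose e : R := 7^-1 * kappa.
have B0 : 0 < B by rewrite /B; lra.
have a20 : 0 < a2 by rewrite exprn_gt0 // divr_gt0.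
have kappa0 : 0 < kappa by rewrite exprn_gt0 // divr_gt0.
have e0 : 0 < e by rewrite mulr_gt0 ?invr_gt0.
have V0 : 0 < e ^+ 2 * a2 by rewrite mulr_gt0 // exprn_gt0.
(* The summand 1 gives [t ^+ 2 >= t], so that the condition [tB] on [t ^+ 2] follows from the
   corresponding one on [t]. *)
pose t : R := 1 + 3 * B ^+ 4 / (2 * (e ^+ 2 * a2)).
have t1 : 1 <= t.
  by rewrite lerDl divr_ge0 ?mulr_ge0 ?exprn_ge0 // ltW // mulr_gt0 // exprn_gt0.
have t0 : 0 < t by apply: lt_le_trans t1.
have tB : 3 * B ^+ 4 <= 2 * (e ^+ 2 * a2) * t ^+ 2.
  apply: (@le_trans _ _ (2 * (e ^+ 2 * a2) * t)); last first.
    apply: ler_wpM2l; first by rewrite mulr_ge0 // ltW.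
    by rewrite expr2 ler_peMr // ltW.
  have : 3 * B ^+ 4 / (2 * (e ^+ 2 * a2)) <= t by rewrite /t; lra.
  by rewrite ler_pdivrMr ?mulr_gt0 // [t * _]mulrC.
pose c0 : R := e ^+ 2 * a2 / (2 * t); have c00 : 0 < c0 by rewrite !(divr_gt0, mulr_gt0).
have k0 : 0 < k%:R :> R by rewrite ltr0n.
pose c1 : R := kappa * c0 / (4 * k%:R); have c10 : 0 < c1 by rewrite !(divr_gt0, mulr_gt0).
(* With [r = c1 * m / sqrt l] as the bound on minus the mean, half of [r] is lost to the deviation,
   an eighth to changed weights and an eighth to changed flips; the remaining quarter is twice
   [c1 / 8]. *)
exists (c1 / 8); first by rewrite divr_gt0.
move=> l l1; pose s : R := Num.sqrt l%:R.
have l0 : 0 < l%:R :> R by rewrite ltr0n.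
have s0 : 0 < s by rewrite sqrtr_gt0.
(* Enough thresholds to push the cost of changed flips below [r / 8]. *)
pose M : nat := (Num.trunc (8 * B * k%:R * s / c1)).+1.
have M0 : 0 < M%:R :> R by rewrite ltr0n.
have MB : B * k%:R / M%:R <= c1 / (8 * s).
  rewrite ler_pdivrMr // [leRHS]mulrAC ler_pdivlMr ?mulr_gt0 //.
  have : 8 * B * k%:R * s / c1 < M%:R by apply: truncnS_gt.
  by rewrite ltr_pdivrMr // => ?; lra.
pose tau : R := c0 / (4 * M%:R); have tau0 : 0 < tau by rewrite !(divr_gt0, mulr_gt0).
(* Equally spaced by [tau], from [- tau] down to [- (c0 / 4)]. *)
pose theta (i : 'I_M) : R := - (tau * i.+1%:R).
(* The first bound keeps twice the displacement [l * dd] of a local field below the spacing [tau];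
   the second limits the cost of changed weights to [r / 8]. *)
pose dd : R := Num.min (tau / (4 * l%:R)) (c1 / (8 * s)).
have dd0 : 0 < dd by rewrite lt_min !(divr_gt0, mulr_gt0).
have dd1 : dd <= tau / (4 * l%:R) by rewrite ge_min lexx.
have dd2 : dd <= c1 / (8 * s) by rewrite ge_min lexx orbT.
(* The bound [a / 4] keeps the recentred values between [a / 2] and [2 * b] in modulus, apart from
   cells of probability zero for the lower bound. The bound [dd / 4] limits the rounding error to
   [dd / 2], and the input error takes the other half of [dd]. *)
pose gamma : R := Num.min (a / 4) (dd / 4).
have gamma0 : 0 < gamma by rewrite lt_min !(divr_gt0, mulr_gt0).
have gamma1 : gamma <= a / 4 by rewrite ge_min lexx.
have gamma2 : gamma <= dd / 4 by rewrite ge_min lexx orbT.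
exists (dd / 2).
  have -> : c1 / 8 / s = c1 / (8 * s) by rewrite invfM mulrA.
  by apply/andP; split; lra.
move=> eps eps0.
(* For [m > K] the Chebyshev bound, which is a constant divided by [m], is below [eps]. *)
pose K : R := (2 * B * (k * l)%:R) ^+ 2 * l%:R * 4 / (c1 ^+ 2 * eps).
exists (Num.trunc K).+1 => m n P d T mu w m_ge P_loc P_deg ind mean bound.
have m0 : (0 < m)%N by apply: leq_trans m_ge.
have mR0 : 0 < m%:R :> R by rewrite ltr0n.
have mK : K < m%:R.
  by apply: lt_le_trans (truncnS_gt K) _; rewrite ler_nat.
split=> //.
pose G := 'I_(grid_size b gamma).
pose p j (g : G) := grid_prob b gamma (w j) g.
pose val j (g : G) := grid_value b gamma (w j) g.
pose r : R := c1 * (m%:R / s).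
have r0 : 0 < r by rewrite mulr_gt0 // divr_gt0.
have p_ge0 j g : 0 <= p j g by exact: grid_prob_ge0.
have p_sum j : \sum_g p j g = 1 by have := grid_prob_sum a0 gamma0 (bound j).
have val_mean j : \sum_g p j g * val j g = 0 by have := grid_value_mean a0 gamma0 (bound j).
have val_le j g : `|val j g| <= B.
  apply: le_trans (grid_value_norm a0 ab gamma0 (mean j) (bound j) g) _.
  by rewrite /B; lra.
have val_sqr j : a2 <= \sum_g p j g * val j g ^+ 2.
  apply: le_trans (grid_value_sqr a0 ab gamma0 (mean j) (bound j) _); last by lra.
  by rewrite /a2 ler_sqr ?nnegrE; lra.
have theta_ge i : - (c0 / 4) <= theta i.
  rewrite lerN2 (_ : c0 / 4 = tau * M%:R); last by rewrite /tau; field; rewrite gt_eqF.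
  by rewrite ler_wpM2l ?ler_nat // ltW.
have theta_lt i : theta i < 0 by rewrite oppr_lt0 mulr_gt0 // ltr0n.
have M1 : (0 < M)%N by [].
have := mean_energy_deviation l1 P_loc P_deg p_ge0 p_sum val_mean val_le (ltW B0)
  (ltW a20) val_sqr t0 tB k1 M1 theta_ge theta_lt (erefl r) r0.
pose bad x := - (r / 2) < mean_energy P theta (sample_weight val x).
move=> dev; have badeps : \sum_(x | bad x) weight p x <= eps.
  apply: (le_trans dev); rewrite ler_pdivrMr ?exprn_gt0 ?divr_gt0 //.
  have ce0 : 0 < c1 ^+ 2 * eps by rewrite mulr_gt0 // exprn_gt0.
  move: mK; rewrite /K ltr_pdivrMr // => /ltW mK.
  have sE : s ^+ 2 = l%:R by rewrite sqr_sqrtr // ltW.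
  have -> : eps * (r / 2) ^+ 2 = m%:R / (4 * s ^+ 2) * (m%:R * (c1 ^+ 2 * eps)).
    by rewrite /r; field; rewrite gt_eqF.
  apply: (@le_trans _ _ (m%:R / (4 * s ^+ 2) * ((2 * B * (k * l)%:R) ^+ 2 * l%:R * 4))).
    by rewrite sE le_eqVlt; apply/orP; left; apply/eqP; field; rewrite gt_eqF.
  by rewrite ler_wpM2l // divr_ge0 ?mulr_ge0 ?exprn_ge0 ?ler0n // ltW.
have [E [mE muE goodE]] := grid_event a0 gamma0 ind bound badeps.
exists E; split=> // om Eom w' w'P.
have [x nbad cell_x] := goodE om Eom.
have [i le_i] : exists i, energy P w' (threshold_rule P w' (theta i)) <=
    - (r / 2) + (dd * m%:R + B * (k * m)%:R / M%:R).
  apply: (@threshold_stable R n m k l P _ P_deg M theta dd B M1 (ltW dd0) (ltW B0) _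
    (sample_weight val x)) => //.
  - by move=> j; case/andP: (P_loc j).
  - move=> i i' ii'; rewrite /theta opprK addrC -mulrBr normrM gtr0_norm //.
    have : 1 <= `|(i'.+1%:R : R) - i.+1%:R|.
      have [lt|gt|ee] := ltngtP (nat_of_ord i) (nat_of_ord i').
      - by rewrite -natrB 1?ltnW // normr_nat ler1n subSS subn_gt0.
      - by rewrite distrC -natrB 1?ltnW // normr_nat ler1n subSS subn_gt0.
      by case/eqP: ii'; apply: val_inj.
    move=> ge1; apply: lt_le_trans (_ : tau * 1 <= _); last by rewrite ler_wpM2l // ltW.
    apply: (@le_lt_trans _ _ (2 * (l%:R * (tau / (4 * l%:R))))).
      by rewrite ler_wpM2l // ler_wpM2l // ltW.
    have -> : 2 * (l%:R * (tau / (4 * l%:R))) = tau / 2 by field; rewrite gt_eqF.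
    by lra.
  - by move=> j; apply: val_le.
  - move=> j; have := w'P j; have := grid_value_dist a0 ab gamma0 (mean j) (bound j) (cell_x j).
    rewrite /sample_weight /val !ler_norml => /andP[? ?] /andP[? ?]; apply/andP; split; lra.
  - by rewrite leNgt.
have [u un uE] := threshold_candidate P w' (theta_lt i).
exists u => //; rewrite -(eq_energy P w' uE); apply: (le_trans le_i).
have -> : - (2 * (c1 / 8) * m%:R / Num.sqrt l%:R) = - (r / 2) + (2 * (c1 / (8 * s))) * m%:R.
  by rewrite /r -/s; field; rewrite gt_eqF.
rewrite lerD2l mulr2n mulrDl mul1r mulrDl lerD ?ler_wpM2r ?(ltW mR0) //.
by rewrite natrM mulrA mulrAC ler_wpM2r // ltW.
Qed.

(** * Product states and the smallest eigenvalue *)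

Section Rayleigh.
Variables (R : realType) (N : nat) (A : 'M[R[i]]_N) (psi : 'cV[R[i]]_N).
Hypotheses (A_herm : forall x y, Num.conj (A x y) = A y x).
Hypothesis psi_norm : \sum_x `|psi x 0| ^+ 2 = 1.

(** In an orthonormal eigenbasis the expectation is a convex combination of the eigenvalues. *)
Lemma smallest_eigenvalue_le : exists lambda : R[i],
  smallest_eigenvalue A lambda /\ lambda <= expectation_value A psi.
Proof.
have hermA : A \is hermsymmx.
  apply/is_hermitianmxP; rewrite expr0 scale1r; apply/matrixP => x y.
  by rewrite !mxE A_herm.
pose U := spectralmx A; pose sp := spectral_diag A.
have AE : A = invmx U *m diag_mx sp *m U.
  exact/orthomx_spectralP/(hermitian_normalmx hermA).
have uU : U \is unitarymx := spectral_unitarymx A.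
have unitU : U \in unitmx := spectral_unit A.
have sp_real i : sp 0 i \is Num.real.
  by move/mxOverP: (hermitian_spectral_diag_real hermA) => /(_ 0 i).
(* The dimension is positive because [psi] is a unit vector. *)
have [i0 _] : exists i0 : 'I_N, true.
  case: (pickP (fun _ : 'I_N => true)) => [i _|no]; first by exists i.
  move: psi_norm; rewrite big1 => [/esym/eqP|x _]; first by rewrite oner_eq0.
  by have := no x.
(* The order of [R[i]] is partial, so the minimum is taken over real parts; the eigenvalues are
   real, which carries it back. *)
pose i1 := [arg min_(i < i0) complex.Re (sp 0 i)]%O.
have sp_min i : sp 0 i1 <= sp 0 i.
  rewrite -(RRe_real (sp_real i)) -(RRe_real (sp_real i1)) lecR.
  by rewrite /i1; case: Order.TotalTheory.arg_minP => // j _; apply.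
exists (sp 0 i1); split; first split.
- apply/eigenvalueP; exists (row i1 U).
    rewrite AE !mulmxA [in LHS]rowE -(mulmxA _ U) mulmxV // mulmx1.
    rewrite [row i1 U]rowE scalemxAl; congr (_ *m U).
    rewrite mul_mx_diag; apply/matrixP => x y; rewrite !mxE.
    by have [->|_] := eqVneq y i1; [rewrite mulrC | rewrite andbF mul0r mulr0].
  apply/eqP => r0; have := rowE i1 U; rewrite r0 => /(congr1 (fun z => z *m invmx U)).
  rewrite mul0mx -mulmxA mulmxV // mulmx1 => /matrixP/(_ 0 i1).
  by rewrite !mxE !eqxx => /esym/eqP; rewrite oner_eq0.
- move=> y /eigenvalueP[v vA v0].
  pose u := v *m invmx U.
  have uD : u *m diag_mx sp = y *: u.
    rewrite /u scalemxAl -vA [in RHS]AE !mulmxA.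
    by rewrite -(mulmxA _ U (invmx U)) mulmxV // mulmx1.
  have [i ui] : exists i, u 0 i != 0.
    apply/existsP; rewrite -negb_forall; apply/negP => /forallP u0.
    case/eqP: v0; rewrite -[v]mulmx1 -(mulVmx unitU) mulmxA -/u.
    by rewrite (_ : u = 0) ?mul0mx //; apply/rowP => j; rewrite [RHS]mxE; apply/eqP/u0.
  move/rowP: uD => /(_ i); rewrite mul_mx_diag [LHS]mxE [RHS]mxE [RHS]mulrC => /(mulfI ui) <-.
  exact: sp_min.
pose phi := U *m psi.
have invU : invmx U = (map_mx Num.conj U)^T.
  by rewrite invmx_unitary // map_trmx.
have phi_conj : (map_mx Num.conj psi)^T *m invmx U = (map_mx Num.conj phi)^T.
  by rewrite invU -trmx_mul -map_mxM.
have dotE (z : 'cV[R[i]]_N) : ((map_mx Num.conj z)^T *m z) 0 0 = \sum_x `|z x 0| ^+ 2.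
  by rewrite mxE; apply: eq_bigr => x _; rewrite !mxE normCKC.
have phi_norm : \sum_x `|phi x 0| ^+ 2 = 1.
  by rewrite -dotE -phi_conj -mulmxA /phi (mulmxA (invmx U)) mulVmx // mul1mx dotE.
rewrite /expectation_value [in leRHS]AE !mulmxA phi_conj -[_ *m U *m psi]mulmxA -/phi.
clearbody phi.
rewrite mxE -[leLHS]mulr1 -phi_norm mulr_sumr; apply: ler_sum => x _.
rewrite mul_mx_diag !mxE mulrAC -normCKC mulrC.
by rewrite ler_wpM2l ?exprn_ge0.
Qed.

End Rayleigh.

Section ProductStates.
Variables (R : realType) (n : nat).

Lemma expectation_valueE (N : nat) (A : 'M[R[i]]_N) (psi : 'cV[R[i]]_N) :
  expectation_value A psi = \sum_x \sum_y Num.conj (psi x 0) * A x y * psi y 0.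
Proof.
rewrite /expectation_value mxE exchange_big /=; apply: eq_bigr => y _.
by rewrite mxE mulr_suml; apply: eq_bigr => x _; rewrite !mxE.
Qed.

Lemma sum_bit_strings (F : bit_string n -> R[i]) :
  \sum_(x < #|bit_string n|) F (enum_val x) = \sum_x F x.
Proof. by rewrite -big_enum_val. Qed.

Lemma expectation_tensor (A : 'I_n -> 'M[R[i]]_2) (phi : 'I_n -> 'cV[R[i]]_2) :
  expectation_value (tensor_op A) (tensor_vec phi) = \prod_q expectation_value (A q) (phi q).
Proof.
pose G (u v : bit_string n) := Num.conj (\prod_(q < n) phi q (u q) 0) *
  \prod_(q < n) A q (u q) (v q) * \prod_(q < n) phi q (v q) 0.
transitivity (\sum_u \sum_v G u v).
  rewrite expectation_valueE -(sum_bit_strings (fun u => \sum_v G u v)).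
  apply: eq_bigr => x _; rewrite -(sum_bit_strings (G (enum_val x))).
  by apply: eq_bigr => y _; rewrite !mxE.
transitivity (\sum_(u : bit_string n) \prod_(q < n) \sum_t
    Num.conj (phi q (u q) 0) * A q (u q) t * phi q t 0).
  apply: eq_bigr => u _; rewrite bigA_distr_bigA; apply: eq_bigr => v _.
  by rewrite /G rmorph_prod -!big_split.
rewrite -(bigA_distr_bigA (fun q s => \sum_t Num.conj (phi q s 0) * A q s t * phi q t 0)).
by apply: eq_bigr => q _; rewrite expectation_valueE.
Qed.

Lemma expectation_hamiltonian (m : nat) (P : 'I_m -> pauli_term n) (w : 'I_m -> R) psi :
  expectation_value (hamiltonian P w) psi =
  \sum_j (w j)%:C * expectation_value (tensor_op (fun q => pauli_mx R (P j q))) psi.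
Proof.
rewrite /expectation_value /hamiltonian mulmx_sumr mulmx_suml summxE; apply: eq_bigr => j _.
by rewrite -scalemxAr -scalemxAl mxE.
Qed.

Lemma pauli_mx_conj s x y : Num.conj (pauli_mx R s x y) = pauli_mx R s y x.
Proof.
case: s; rewrite !mxE [in RHS]eq_sym.
- by rewrite conjC_nat.
- by rewrite conjC_nat.
- by case: x => [[|[|x]] ix] //; case: y => [[|[|y]] iy] //; apply/eqP;
    rewrite eq_complex /= ?opprK ?oppr0 ?eqxx ?eqxx.
by have [->|_] := eqVneq x y; rewrite ?conjC0 // rmorphXn rmorphN1.
Qed.

Lemma hamiltonian_conj (m : nat) (P : 'I_m -> pauli_term n) (w : 'I_m -> R) x y :
  Num.conj (hamiltonian P w x y) = hamiltonian P w y x.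
Proof.
rewrite !summxE rmorph_sum; apply: eq_bigr => j _; rewrite !mxE rmorphM rmorph_prod.
congr (_ * _); first by apply/eqP; rewrite eq_complex /= oppr0 !eqxx.
by apply: eq_bigr => q _; exact: pauli_mx_conj.
Qed.

Lemma tensor_vec_norm (phi : 'I_n -> 'cV[R[i]]_2) :
  (forall q, \sum_s `|phi q s 0| ^+ 2 = 1) -> \sum_x `|tensor_vec phi x 0| ^+ 2 = 1.
Proof.
move=> phi1; under eq_bigr do rewrite mxE normr_prod -prodrXl.
rewrite (sum_bit_strings (fun u => \prod_(q < n) `|phi q (u q) 0| ^+ 2)).
by rewrite -(bigA_distr_bigA (fun q s => `|phi q s 0| ^+ 2)) big1.
Qed.

End ProductStates.

Lemma nth_flatten_block (T : Type) (x0 : T) (B : nat) (ss : seq (seq T)) (i t : nat) :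
  all (fun s => size s == B) ss -> (t < B)%N -> (i < size ss)%N ->
  nth x0 (flatten ss) (i * B + t) = nth x0 (nth [::] ss i) t.
Proof.
move=> + tB; elim: ss i => // s ss IH [|i] /= /andP[/eqP sB sss] lt; rewrite nth_cat sB.
  by rewrite mul0n add0n tB.
by rewrite mulSn -addnA ltnNge leq_addr /= addKn IH.
Qed.

(* Unnormalized spinors with Bloch vectors (3, 6, 2) / 7 and (6, 2, 3) / 7:
   (3, 1 + 2i) and (5, 3 + i). *)
Definition spinor_code (b : bool) : seq nat :=
  if b then [:: 5; 0; 0; 0; 3; 0; 1; 0]%N else [:: 3; 0; 0; 0; 1; 0; 2; 0]%N.

Definition state_code (n : nat) (bits : 'I_n -> bool) : seq nat :=
  flatten [seq spinor_code (bits q) | q <- enum 'I_n].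

Section Spinors.
Variable R : realType.

Definition spinor (b : bool) : 'cV[R[i]]_2 := qubit_at R (spinor_code b) 0.

Lemma spinor0 b : spinor b 0 0 = (if b then 5 +i* 0 else 3 +i* 0).
Proof. by rewrite mxE /gaussian_at; case: b => /=; rewrite !subr0. Qed.

Lemma spinor1 b : spinor b 1 0 = (if b then 3 +i* 1 else 1 +i* 2).
Proof. by rewrite mxE /gaussian_at; case: b => /=; rewrite !subr0. Qed.

Lemma spinor_neq0 b : spinor b != 0.
Proof.
apply/eqP => /matrixP/(_ 0 0); rewrite spinor0 mxE => /eqP.
by rewrite eq_complex; case: b; rewrite /= pnatr_eq0.
Qed.

Lemma normalize_norm (v : 'cV[R[i]]_2) : v != 0 -> \sum_s `|normalize v s 0| ^+ 2 = 1.
Proof.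
move=> v0; set S := \sum_s `|v s 0| ^+ 2.
have S0 : 0 < S.
  rewrite lt_neqAle sumr_ge0 ?andbT => [|s _]; last by rewrite exprn_ge0.
  apply: contra_neqN v0 => /eqP/esym/eqP; rewrite psumr_eq0 => [/allP v0|s _]; last by rewrite exprn_ge0.
  apply/matrixP => s t; rewrite ord1 mxE; have := v0 s (mem_index_enum _).
  by rewrite /= expf_eq0 /= normr_eq0 => /eqP.
rewrite /normalize -/S; under eq_bigr do rewrite mxE normrM exprMn.
rewrite -mulr_sumr -/S normfV exprVn -normrX sqrtCK gtr0_norm // mulVf //.
by rewrite gt_eqF.
Qed.

Lemma expectation_normalize (A : 'M[R[i]]_2) (v : 'cV[R[i]]_2) :
  expectation_value A (normalize v) =
  (\sum_s `|v s 0| ^+ 2)^-1 * expectation_value A v.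
Proof.
set S := \sum_s `|v s 0| ^+ 2.
have S0 : 0 <= S by apply: sumr_ge0 => s _; rewrite exprn_ge0.
have conjE x : Num.conj (normalize v x 0) = (sqrtC S)^-1 * Num.conj (v x 0).
  rewrite mxE -/S rmorphM; congr (_ * _).
  by apply/CrealP; rewrite rpredV ger0_real // sqrtC_ge0.
have SE : S^-1 = (sqrtC S)^-1 * (sqrtC S)^-1 by rewrite -invfM -expr2 sqrtCK.
rewrite !expectation_valueE mulr_sumr; apply: eq_bigr => x _.
rewrite mulr_sumr; apply: eq_bigr => y _; rewrite conjE mxE -/S SE.
by ring.
Qed.

Lemma expectation_spinor s b :
  expectation_value (pauli_mx R s) (normalize (spinor b)) = (bloch R s b)%:C.
Proof.
(* The squared norms of the spinors: 25 + 9 + 1 = 35 and 9 + 1 + 4 = 14. *)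
pose S (c : bool) : R := if c then 35 else 14.
have l01 : lift ord0 ord0 = 1 :> 'I_2 by apply/val_inj.
have sE : \sum_s `|spinor b s 0| ^+ 2 = (S b)%:C.
  rewrite !big_ord_recl !big_ord0 !addr0 l01 -[ord0]/(0 : 'I_2) !normCK !spinor0 !spinor1 /S.
  by case: b; apply/eqP; rewrite eq_complex /=; apply/andP; split; apply/eqP; ring.
have eE : expectation_value (pauli_mx R s) (spinor b) = (S b * bloch R s b)%:C.
  rewrite expectation_valueE !big_ord_recl !big_ord0 !addr0 l01 -[ord0]/(0 : 'I_2).
  rewrite !spinor0 !spinor1 /bloch /S.
  by clear sE; case: s; case: b; rewrite !mxE; apply/eqP; rewrite eq_complex /=; apply/andP; split;
    apply/eqP; field.
by rewrite expectation_normalize sE eE -rmorphV -?rmorphM /= ?mulKf //;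
  rewrite ?unitfE /S; clear; case: b; rewrite pnatr_eq0.
Qed.

End Spinors.

Section StateCode.
Variables (R : realType) (n : nat) (bits : 'I_n -> bool).

Let all_size : all (fun s => size s == 8%N) [seq spinor_code (bits q) | q <- enum 'I_n].
Proof. by rewrite all_map; apply/allP => q _ /=; case: (bits q). Qed.

Lemma size_state_code : size (state_code bits) = (8 * n)%N.
Proof.
rewrite size_flatten /shape -map_comp sumnE big_map big_enum /=.
rewrite (eq_bigr (fun=> 8%N)) => [|q _]; last by case: (bits q).
by rewrite sum_nat_const card_ord mulnC.
Qed.

Lemma qubit_state_code (q : 'I_n) : qubit_at R (state_code bits) q = spinor R (bits q).
Proof.
apply/matrixP => v z; rewrite !mxE /gaussian_at.
have nthE t : (t < 8)%N -> nth 0%N (state_code bits) (8 * q + t) = nth 0%N (spinor_code (bits q)) t.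
  move=> t8; rewrite [(8 * q)%N]mulnC (nth_flatten_block _ all_size) ?size_map -?enumT ?size_enum_ord //.
  by rewrite (nth_map q) -?enumT ?size_enum_ord // nth_ord_enum.
have v4 : (4 * v + 3 < 8)%N by case: v => [[|[|v]]].
by rewrite -!addnS !nthE // ?muln0 ?add0n; lia.
Qed.

Lemma describes_state_code :
  describes_product_state (state_code bits) (fun q => normalize (spinor R (bits q))).
Proof.
by split=> [|q]; rewrite ?size_state_code // qubit_state_code spinor_neq0.
Qed.

Lemma expectation_state_code (m : nat) (P : 'I_m -> pauli_term n) (w : 'I_m -> R) :
  expectation_value (hamiltonian P w) (tensor_vec (fun q => normalize (spinor R (bits q))))
  = (energy P w bits)%:C.
Proof.
rewrite expectation_hamiltonian /energy rmorph_sum; apply: eq_bigr => j _.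
rewrite expectation_tensor rmorphM; congr (_ * _).
by rewrite /term_value rmorph_prod; apply: eq_bigr => q _; rewrite expectation_spinor.
Qed.

End StateCode.

(** * Random access machine programs *)

(** A total-correctness Hoare triple with a time bound. An upper bound in place of the exact time
    lets the two branches of a conditional share one bound. *)
Definition runs (c : com) (s : machine) (T : nat) (Q : machine -> Prop) : Prop :=
  exists t s', [/\ exec c s t s', (t <= T)%N & Q s'].

Lemma runs_weaken c s T T' (Q Q' : machine -> Prop) :
  runs c s T Q -> (T <= T')%N -> (forall s', Q s' -> Q' s') -> runs c s T' Q'.
Proof.
move=> [t [s' [ex le Qs]]] leT QQ; exists t, s'; split=> //; last exact: QQ.
exact: leq_trans leT.
Qed.

Lemma runs_seq c1 c2 s T1 T2 Q :
  runs c1 s T1 (fun s1 => runs c2 s1 T2 Q) -> runs (Seq c1 c2) s (T1 + T2) Q.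
Proof.
move=> [t1 [s1 [ex1 le1 [t2 [s2 [ex2 le2 Q2]]]]]]; exists (t1 + t2)%N, s2.
by split=> //; [exact: exec_seq ex1 ex2 | exact: leq_add].
Qed.

Lemma runs_if r c1 c2 s T (Q : machine -> Prop) :
  (regs s r != 0%N -> runs c1 s T Q) -> (regs s r = 0%N -> runs c2 s T Q) ->
  runs (If r c1 c2) s T.+1 Q.
Proof.
move=> h1 h2; have [r0|r0] := eqVneq (regs s r) 0%N.
  by have [t [s' [ex le Qs]]] := h2 r0; exists t.+1, s'; split=> //; exact: exec_if_false.
by have [t [s' [ex le Qs]]] := h1 r0; exists t.+1, s'; split=> //; exact: exec_if_true.
Qed.

(** Every loop below counts its test register down by one, so this register determines the index of
    the invariant and gives termination. *)
Lemma runs_loop r c N T (I : nat -> machine -> Prop) s :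
  regs s r = N -> I 0%N s ->
  (forall i s, (i < N)%N -> regs s r = (N - i)%N -> I i s ->
    runs c s T (fun s' => regs s' r = (N - i.+1)%N /\ I i.+1 s')) ->
  runs (While r c) s (N * T.+1).+1 (I N).
Proof.
move=> rN I0 body.
have main k i s1 : (i + k = N)%N -> regs s1 r = k -> I i s1 ->
    runs (While r c) s1 (k * T.+1).+1 (I N).
  elim: k i s1 => [|k IH] i s1 ik r1 I1.
    exists 1%N, s1; split=> //; first exact: exec_while_false.
    by rewrite -ik addn0.
  have iN : (i < N)%N by lia.
  have [|t1 [s2 [ex1 le1 [r2 I2]]]] := body i s1 iN _ I1; first by rewrite r1; lia.
  have [||t2 [s3 [ex2 le2 Q3]]] := IH i.+1 s2 _ _ I2; [lia | lia |].
  exists (t1 + t2).+1, s3; split=> //; last by rewrite mulSn; lia.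
  by apply: exec_while_true ex1 ex2; rewrite r1.
exact: main N 0%N s (add0n N) rN I0.
Qed.

Lemma set_reg_eq s r v : regs (set_reg s r v) r = v.
Proof. by rewrite /= /upd eqxx. Qed.

Lemma set_reg_ne s r v i : i != r -> regs (set_reg s r v) i = regs s i.
Proof. by rewrite /= /upd => /negbTE ->. Qed.

Definition block (cs : seq com) : com := foldr Seq Skip cs.
Arguments block : simpl never.

Lemma runs_nil s T (Q : machine -> Prop) : Q s -> runs (block [::]) s T.+1 Q.
Proof. by move=> Qs; exists 1%N, s; split=> //; exact: exec_skip. Qed.

Lemma runs_cons c cs s T1 T2 Q :
  runs c s T1 (fun s1 => runs (block cs) s1 T2 Q) -> runs (block (c :: cs)) s (T1 + T2) Q.
Proof. exact: runs_seq. Qed.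

Lemma runs_step c cs s s1 T Q :
  exec c s 1 s1 -> runs (block cs) s1 T Q -> runs (block (c :: cs)) s T.+1 Q.
Proof. by move=> ex h; apply: (@runs_cons c cs s 1 T Q); exists 1%N, s1. Qed.

Definition runs_const r v cs s T Q := @runs_step _ cs s _ T Q (exec_const s r v).
Definition runs_add r a b cs s T Q := @runs_step _ cs s _ T Q (exec_add s r a b).
Definition runs_sub r a b cs s T Q := @runs_step _ cs s _ T Q (exec_sub s r a b).
Definition runs_fetch r a cs s T Q := @runs_step _ cs s _ T Q (exec_fetch s r a).
Definition runs_write r cs s T Q := @runs_step _ cs s _ T Q (exec_write s r).

Ltac step := first [apply: runs_const | apply: runs_add | apply: runs_sub
  | apply: runs_fetch | apply: runs_write].

(** The frame condition of a subprogram working in the registers from [o] on. It allows one energy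
    computation to run inside another with a higher offset. *)
Definition keeps (o : nat) (s s' : machine) : Prop :=
  [/\ forall r, (r < o)%N -> regs s' r = regs s r, memory s' = memory s & written s' = written s].

Lemma keeps_trans o o' s1 s2 s3 : (o <= o')%N ->
  keeps o s1 s2 -> keeps o' s2 s3 -> keeps o s1 s3.
Proof.
move=> oo [r1 m1 w1] [r2 m2 w2]; split=> [r ro||]; rewrite ?m2 ?w2 //.
by rewrite r2 ?r1 // (leq_trans ro).
Qed.

Lemma keeps_set_reg o s s' r v : (o <= r)%N -> keeps o s s' -> keeps o s (set_reg s' r v).
Proof.
move=> ro [r1 m1 w1]; split=> // i io; rewrite /= /upd ifN ?r1 //.
by rewrite neq_ltn (leq_trans io).
Qed.

(** The machine cannot multiply, but the only multipliers needed are Bloch components, fixed numbers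
    of size at most 7, so the product is unrolled into additions. *)
Definition mul_const (t r tmp : nat) : com :=
  block (Const tmp 0 :: nseq t (Add tmp tmp r) ++ [:: Const r 0; Add r r tmp]).

Lemma runs_mul_const t r tmp s : r != tmp ->
  runs (mul_const t r tmp) s (t + 4) (fun s' =>
    [/\ regs s' r = (t * regs s r)%N, memory s' = memory s, written s' = written s
      & forall i, i != r -> i != tmp -> regs s' i = regs s i]).
Proof.
move=> rt; rewrite addnS; step.
suff main v s1 : [/\ regs s1 tmp = v, regs s1 r = regs s r, memory s1 = memory s,
      written s1 = written s & forall i, i != r -> i != tmp -> regs s1 i = regs s i] ->
    runs (block (nseq t (Add tmp tmp r) ++ [:: Const r 0; Add r r tmp])) s1 (t + 3) (fun s' =>
      [/\ regs s' r = (t * regs s r + v)%N, memory s' = memory s, written s' = written s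
        & forall i, i != r -> i != tmp -> regs s' i = regs s i]).
  rewrite -[(t * regs s r)%N]addn0; apply: main.
  by split=> //=; rewrite /upd ?eqxx ?(negbTE rt) // => i _ /negbTE ->.
elim: t s1 v => [|t IH] s1 v [v1 r1 m1 w1 k1] /=.
  step; step; apply: runs_nil; split=> //=.
    by rewrite /upd !eqxx eq_sym (negbTE rt) v1 mul0n.
  by move=> i ir it; rewrite /upd !(negbTE ir) k1.
step; rewrite mulSn -addnA addnCA; apply: IH; split=> //=; rewrite /upd ?eqxx ?(negbTE rt) //.
  by rewrite v1 r1 addnC.
by move=> i ir it; rewrite (negbTE it) k1.
Qed.

(** * Computing the energy of a product state *)

Section EnergyProgram.
Local Open Scope nat_scope.
Variables (o : nat) (bit : com).

Definition mul_both (t : nat) : com :=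
  block [:: mul_const t (o + 4) (o + 9); mul_const t (o + 5) (o + 9)].

Lemma runs_mul_both t s : (t <= 7)%N -> runs (mul_both t) s 23 (fun s' =>
  [/\ [/\ regs s' (o + 4) = (t * regs s (o + 4))%N & regs s' (o + 5) = (t * regs s (o + 5))%N],
      memory s' = memory s, written s' = written s
    & forall i, i != (o + 4)%N -> i != (o + 5)%N -> i != (o + 9)%N -> regs s' i = regs s i]).
Proof.
move=> t7; apply: (@runs_cons _ _ s 11 12).
have n1 : (o + 4 != o + 9)%N by rewrite eqn_add2l.
have n2 : (o + 5 != o + 9)%N by rewrite eqn_add2l.
apply: (runs_weaken (runs_mul_const t s n1)) => [|s1 [r1 m1 w1 k1]]; first by lia.
apply: (@runs_cons _ _ s1 11 1).
apply: (runs_weaken (runs_mul_const t s1 n2)) => [|s2 [r2 m2 w2 k2]]; first by lia.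
apply: runs_nil; split; rewrite ?m2 ?w2 //.
  split; first by rewrite k2 ?eqn_add2l.
  by rewrite r2 k1 ?eqn_add2l.
by move=> i i4 i5 i9; rewrite k2 // k1.
Qed.

Definition mul_pair (t0 t1 : nat) : com := If (o + 10) (mul_both t1) (mul_both t0).

(* Multiplies the registers o + 4 and o + 5 by the Bloch component selected by the
   Pauli code in register o + 8 and the bit in register o + 10. *)
Definition mul_table : com :=
  If (o + 8)
    (block [:: Defs.Sub (o + 11) (o + 8) 1;
      If (o + 11)
        (block [:: Defs.Sub (o + 12) (o + 11) 1; If (o + 12) (mul_pair 2 3) (mul_pair 6 2)])
        (mul_pair 3 6)])
    (mul_both 7).

Definition table_post (t : nat) (s s' : machine) : Prop :=
  [/\ keeps (o + 4) s s',
    [/\ regs s' (o + 4) = (t * regs s (o + 4))%N & regs s' (o + 5) = (t * regs s (o + 5))%N]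
    & [/\ regs s' (o + 6) = regs s (o + 6) & regs s' (o + 7) = regs s (o + 7)]]%N.

Lemma runs_mul_pair t0 t1 s : (t0 <= 7)%N -> (t1 <= 7)%N ->
  runs (mul_pair t0 t1) s 24 (table_post (if regs s (o + 10) != 0%N then t1 else t0) s).
Proof.
move=> h0 h1; apply: runs_if => [->|->] /=;
  apply: (runs_weaken (runs_mul_both s _)) => // s' [[r4 r5] m1 w1 k1].
all: split; [split=> // r ro; apply: k1; apply/eqP; lia | by rewrite r4 r5 |].
all: by split; apply: k1; rewrite eqn_add2l.
Qed.

Lemma runs_mul_table s : (1 < o)%N -> regs s 1 = 1%N ->
  runs mul_table s 40
    (table_post (bloch_table (regs s (o + 8)) (regs s (o + 10) != 0%N)) s).
Proof.
move=> o1 one.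
have [c0|c0] := eqVneq (regs s (o + 8)) 0%N.
  apply: (@runs_weaken _ _ 24 40 _ _ _ _ (fun _ => id)) => //.
  apply: runs_if => [|_]; first by rewrite c0.
  apply: (runs_weaken (runs_mul_both s _)) => // s' [[r4 r5] m1 w1 k1].
  split; [split=> // r ro; apply: k1; apply/eqP; lia | by rewrite r4 r5 c0 |].
  by split; apply: k1; rewrite eqn_add2l.
apply: runs_if => [_|c0']; last by rewrite c0' in c0.
step; set s1 := set_reg _ _ _.
have k1 i : (i < 11)%N -> regs s1 (o + i) = regs s (o + i).
  by move=> i11; rewrite /s1 /= /upd eqn_add2l (ltn_eqF i11).
have ks1 : keeps (o + 11) s s1 by apply: keeps_set_reg.
have one1 : regs s1 1 = 1%N by case: ks1 => -> //; lia.
have c1E : regs s1 (o + 11) = (regs s (o + 8) - 1)%N by rewrite /s1 /= /upd eqxx one.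
have post t s2 s' : (forall i, (i < 11)%N -> regs s2 (o + i) = regs s (o + i)) ->
    keeps (o + 11) s s2 -> table_post t s2 s' -> table_post t s s'.
  move=> k2 ks2 [ks [r4 r5] [r6 r7]]; split.
  - by apply: keeps_trans ks => //; case: ks2 => h1 h2 h3; split=> // r ro; apply: h1; lia.
  - by rewrite r4 r5 !k2.
  by rewrite r6 r7 !k2.
apply: (@runs_cons _ _ s1 37 1).
have done t s' : table_post t s s' -> runs (block [::]) s' 1 (table_post t s).
  by move=> h; apply: runs_nil.
apply: runs_if => c1; last first.
  have cE : regs s (o + 8) = 1%N by lia.
  apply: (runs_weaken (@runs_mul_pair 3 6 s1 _ _)) => // s' h.
  by rewrite k1 // in h; apply: done; rewrite cE; apply: post h.
have [c c1E' cE] : exists2 c, c1E = c1E & regs s (o + 8) = c.+2.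
  by exists (regs s (o + 8) - 2)%N => //; rewrite c1E in c1; lia.
step; set s2 := set_reg _ _ _.
have k2 i : (i < 11)%N -> regs s2 (o + i) = regs s (o + i).
  move=> i11; rewrite -(k1 _ i11) {1}/s2 /= /upd eqn_add2l.
  by have -> : (i == 12) = false by lia.
have ks2 : keeps (o + 11) s s2 by apply: keeps_set_reg => //; lia.
have c2E : regs s2 (o + 12) = c by rewrite set_reg_eq c1E one1 cE; lia.
apply: (@runs_cons _ _ s2 34 1).
apply: runs_if => c2; rewrite c2E in c2.
  apply: (runs_weaken (@runs_mul_pair 2 3 s2 _ _)) => // s' h.
  apply: runs_nil; apply: done.
  rewrite cE; case: c c2 {cE c2E} => // c _ /=.
  by rewrite k2 // in h; apply: post h.
apply: (runs_weaken (@runs_mul_pair 6 2 s2 _ _)) => // s' h.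
apply: runs_nil; apply: done.
rewrite cE c2 /=.
by rewrite k2 // in h; apply: post h.
Qed.

(** The parameter [bit] has to leave the bit of the qubit numbered by register [o + 3] in register
    [o + 10]; it may itself contain an energy computation. *)
Definition bit_step : com :=
  block [:: bit; Add (o + 8) (o + 1) (o + 3); Fetch (o + 8) (o + 8); mul_table;
    Add (o + 3) (o + 3) 1; Defs.Sub (o + 2) (o + 2) 1].

(* Each term is stored as n Pauli codes followed by the positive and the negative
   part of its weight; register o + 1 points to the current term, the first one
   being at address 4. Registers 1, 2, 3 hold 1, n and m. *)
Definition energy_step : com :=
  block [:: Add (o + 8) (o + 1) 2; Fetch (o + 4) (o + 8); Add (o + 8) (o + 8) 1;
    Fetch (o + 5) (o + 8); Const (o + 3) 0; Const (o + 9) 0; Add (o + 2) 2 (o + 9);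
    While (o + 2) bit_step;
    Add (o + 6) (o + 6) (o + 4); Add (o + 7) (o + 7) (o + 5); Add (o + 1) (o + 1) 2;
    Const (o + 8) 2; Add (o + 1) (o + 1) (o + 8); Defs.Sub (o + 0) (o + 0) 1].

Definition energy_program : com :=
  block [:: Const (o + 6) 0; Const (o + 7) 0; Const (o + 9) 0; Add (o + 0) 3 (o + 9);
    Const (o + 1) 4; While (o + 0) energy_step].

Variables (s0 : machine) (n m Tb : nat) (beta : nat -> bool).
Hypotheses (o3 : 3 < o) (one : regs s0 1 = 1) (reg_n : regs s0 2 = n) (reg_m : regs s0 3 = m).
Hypothesis run_bit : forall s, keeps o s0 s -> regs s (o + 3) < n ->
  runs bit s Tb (fun s' => keeps (o + 10) s s' /\ (regs s' (o + 10) != 0) = beta (regs s (o + 3))).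

Let low s : keeps o s0 s -> [/\ regs s 1 = 1, regs s 2 = n, regs s 3 = m & memory s = memory s0].
Proof. by move=> [r me w]; rewrite !r //; lia. Qed.

Let table_prod (base i : nat) : nat :=
  \prod_(q < i) bloch_table (memory s0 (base + q)) (beta q).

Let inner_inv (s1 : machine) (i : nat) (s : machine) : Prop :=
  [/\ keeps (o + 2) s1 s, regs s (o + 3) = i,
    [/\ regs s (o + 4) = regs s1 (o + 4) * table_prod (regs s1 (o + 1)) i
      & regs s (o + 5) = regs s1 (o + 5) * table_prod (regs s1 (o + 1)) i]
    & [/\ regs s (o + 6) = regs s1 (o + 6) & regs s (o + 7) = regs s1 (o + 7)]].

Let keeps_add j s1 s2 s3 : keeps o s1 s2 -> keeps (o + j) s2 s3 -> keeps o s1 s3.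
Proof. exact/keeps_trans/leq_addr. Qed.

Let run_bit_step s1 i s : keeps o s0 s1 -> i < n -> regs s (o + 2) = n - i -> inner_inv s1 i s ->
  runs bit_step s (Tb + 45) (fun s' => regs s' (o + 2) = n - i.+1 /\ inner_inv s1 i.+1 s').
Proof.
move=> k01 lt r2 [k1s r3 [r4 r5] [r6 r7]].
have k0s : keeps o s0 s by apply: keeps_add k01 k1s.
apply: runs_cons; apply: (runs_weaken (run_bit k0s _)) => //; first by rewrite r3.
move=> sb [ksb rb].
have rsb j : j < 10 -> regs sb (o + j) = regs s (o + j).
  by move=> j10; case: ksb => -> //; rewrite ltn_add2l.
have k0b : keeps o s0 sb by apply: keeps_add k0s ksb.
step; step; set s3 := set_reg (set_reg _ _ _) _ _.
have r3s j : j != 8 -> regs s3 (o + j) = regs sb (o + j).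
  by move=> j8; rewrite !set_reg_ne ?eqn_add2l.
have r38 : regs s3 (o + 8) = memory s0 (regs s1 (o + 1) + i).
  rewrite set_reg_eq set_reg_eq !rsb // r3.
  have [_ _ _ ->] := low k0b.
  by case: k1s => -> //; rewrite ltn_add2l.
have k03 : keeps o s0 s3 by apply: keeps_set_reg _ _ (keeps_set_reg _ _ k0b); apply: leq_addr.
have [one3 _ _ _] := low k03.
apply: (@runs_cons _ _ s3 40 3).
apply: (runs_weaken (runs_mul_table _ one3)) => //; first by lia.
move=> s4 [k34 [r44 r45] [r46 r47]].
have k04 : keeps o s0 s4 by apply: keeps_add k03 k34.
have [one4 _ _ _] := low k04.
have r4low j : j < 4 -> regs s4 (o + j) = regs s (o + j).
  move=> j4; case: k34 => -> //; rewrite ?ltn_add2l // r3s; last by lia.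
  by rewrite rsb //; lia.
step; step; apply: runs_nil; split.
  by rewrite set_reg_eq !set_reg_ne ?eqn_add2l ?r4low ?r2 ?one4 //; [lia | apply/eqP; lia].
rewrite r38 r3s // rb r3 in r44 r45.
split.
- have k13 : keeps (o + 2) s1 s3.
    apply: keeps_set_reg; rewrite ?leq_add2l //; apply: keeps_set_reg; rewrite ?leq_add2l //.
    by apply: keeps_trans k1s ksb; rewrite leq_add2l.
  apply: keeps_set_reg; rewrite ?leq_add2l //; apply: keeps_set_reg; rewrite ?leq_add2l //.
  by apply: keeps_trans k13 k34; rewrite leq_add2l.
- rewrite set_reg_ne ?eqn_add2l // set_reg_eq r4low // r3 one4; lia.
- rewrite !set_reg_ne ?eqn_add2l // r44 r45 !r3s // !rsb // r4 r5 /table_prod big_ord_recr /=.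
  by split; rewrite mulnCA; congr (_ * _); exact: mulnC.
by rewrite !set_reg_ne ?eqn_add2l // r46 r47 !r3s // !rsb.
Qed.

Definition energy_time : nat := m * (n * (Tb + 46) + 20) + 10.

(* The numerator of the energy, with off = 0 for the positive and off = 1 for the
   negative parts of the weights. *)
Definition energy_part (mem : nat -> nat) (n' : nat) (b : nat -> bool) (off i : nat) : nat :=
  \sum_(j < i) mem (4 + j * (n' + 2) + n' + off) *
    \prod_(q < n') bloch_table (mem (4 + j * (n' + 2) + q)) (b q).

Let part := energy_part (memory s0) n beta.

Let outer_inv (i : nat) (s : machine) : Prop :=
  [/\ keeps o s0 s, regs s (o + 1) = 4 + i * (n + 2)
    & [/\ regs s (o + 6) = part 0 i & regs s (o + 7) = part 1 i]].

Let run_energy_step i s : i < m -> regs s (o + 0) = m - i -> outer_inv i s ->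
  runs energy_step s (n * (Tb + 46) + 19)
    (fun s' => regs s' (o + 0) = m - i.+1 /\ outer_inv i.+1 s').
Proof.
move=> lt r0 [k0s r1 [r6 r7]].
have [one_s n_s m_s mem_s] := low k0s.
apply: (@runs_weaken _ _ (7 + ((n * (Tb + 45).+1).+1 + 7)) _ _ _ _ _ (fun _ => id)).
  step; step; step; step; step; step; step.
  set s1 := set_reg _ _ _.
  have k01 : keeps o s0 s1.
    rewrite /s1; do 7![apply: keeps_set_reg; first exact: leq_addr].
    exact: k0s.
  have lowne r j : r < 4 -> r != o + j by move=> r4; apply/eqP; lia.
  have s10 : regs s1 (o + 0) = m - i by rewrite !set_reg_ne ?eqn_add2l.
  have s11 : regs s1 (o + 1) = 4 + i * (n + 2) by rewrite !set_reg_ne ?eqn_add2l.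
  have s16 : regs s1 (o + 6) = part 0 i by rewrite !set_reg_ne ?eqn_add2l.
  have s17 : regs s1 (o + 7) = part 1 i by rewrite !set_reg_ne ?eqn_add2l.
  have s14 : regs s1 (o + 4) = memory s0 (4 + i * (n + 2) + n + 0).
    do 5![rewrite set_reg_ne ?eqn_add2l //].
    by rewrite !set_reg_eq r1 n_s addn0 [memory _]mem_s.
  have s15 : regs s1 (o + 5) = memory s0 (4 + i * (n + 2) + n + 1).
    do 3![rewrite set_reg_ne ?eqn_add2l //].
    rewrite !set_reg_eq [memory _]mem_s set_reg_ne ?eqn_add2l // set_reg_eq.
    by rewrite !set_reg_ne ?lowne // one_s r1 n_s.
  have s12 : regs s1 (o + 2) = n.
    by rewrite set_reg_eq (set_reg_eq _ (o + 9)) addn0 !set_reg_ne ?lowne.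
  have s13 : regs s1 (o + 3) = 0.
    by rewrite set_reg_ne ?eqn_add2l // set_reg_ne ?eqn_add2l // set_reg_eq.
  apply: runs_cons; apply: (runs_weaken (runs_loop (I := inner_inv s1) s12 _ _)).
  - split=> //; split; rewrite ?/table_prod ?big_ord0 ?muln1 //.
  - by move=> j s' jn r2 inv; apply: run_bit_step.
  - by [].
  move=> s2 [k12 _ [r4 r5] [r6' r7']].
  have k02 : keeps o s0 s2 by apply: keeps_add k01 k12.
  have [one2 n2 _ _] := low k02.
  have k12r j : j < 2 -> regs s2 (o + j) = regs s1 (o + j).
    by move=> j2; case: k12 => -> //; rewrite ltn_add2l.
  step; step; step; step; step; step; apply: runs_nil.
  set s3 := set_reg _ _ _.
  have partS off : part off i.+1 = part off i + memory s0 (4 + i * (n + 2) + n + off) *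
      table_prod (4 + i * (n + 2)) n.
    by rewrite /part /energy_part big_ord_recr.
  have k03 : keeps o s0 s3.
    rewrite /s3; do 6![apply: keeps_set_reg; first exact: leq_addr].
    exact: k02.
  split; last split=> //.
  - rewrite set_reg_eq !set_reg_ne ?eqn_add2l ?lowne // k12r // s10 one2; lia.
  - rewrite set_reg_ne ?eqn_add2l // set_reg_eq [regs _ (o + 8)]set_reg_eq.
    rewrite set_reg_ne ?eqn_add2l // set_reg_eq.
    rewrite !set_reg_ne ?eqn_add2l ?lowne // k12r // s11 n2; lia.
  rewrite !partS -s14 -s15 -s11 -s16 -s17.
  do 4![rewrite set_reg_ne ?eqn_add2l //]; split.
    by rewrite set_reg_ne ?eqn_add2l // set_reg_eq r6' r4.
  do 4![rewrite set_reg_ne ?eqn_add2l //].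
  by rewrite set_reg_eq; do 2![rewrite set_reg_ne ?eqn_add2l //]; rewrite r7' r5.
by rewrite mulnS; lia.
Qed.

Lemma runs_energy s : keeps o s0 s ->
  runs energy_program s energy_time (fun s' =>
    [/\ keeps o s s', regs s' (o + 6) = part 0 m & regs s' (o + 7) = part 1 m]).
Proof.
move=> k0s; have [one_s n_s m_s mem_s] := low k0s.
have lowne r j : r < 4 -> r != o + j by move=> r4; apply/eqP; lia.
apply: (@runs_weaken _ _ (5 + ((m * (n * (Tb + 46) + 19).+1).+1 + 1)) _ _ _ _ _ (fun _ => id)).
  step; step; step; step; step; set s1 := set_reg _ _ _.
  have ks1 : keeps o s s1.
    by rewrite /s1; do 5![apply: keeps_set_reg; first exact: leq_addr].
  have k01 : keeps o s0 s1 by apply: keeps_trans k0s ks1.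
  have s10 : regs s1 (o + 0) = m.
    rewrite set_reg_ne ?eqn_add2l // set_reg_eq [regs _ (o + 9)]set_reg_eq addn0.
    by rewrite !set_reg_ne ?lowne.
  apply: runs_cons; apply: (runs_weaken (runs_loop (I := outer_inv) s10 _ _)).
  - split=> //; first by rewrite set_reg_eq.
    rewrite /part /energy_part !big_ord0; split.
      by do 4![rewrite set_reg_ne ?eqn_add2l //]; rewrite set_reg_eq.
    by do 3![rewrite set_reg_ne ?eqn_add2l //]; rewrite set_reg_eq.
  - by move=> i s' im r0 inv; apply: run_energy_step.
  - by [].
  move=> s2 [k02 _ [r6 r7]]; apply: runs_nil; split=> //.
  case: k02 => h1 h2 h3; case: k0s => g1 g2 g3.
  by split=> [r ro||]; rewrite ?h1 ?h2 ?h3 ?g1 ?g2 ?g3.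
rewrite /energy_time -addnS; lia.
Qed.

End EnergyProgram.

(** * The search over all candidates *)

Section MainProgram.
Local Open Scope nat_scope.

(* Sets register 50 to 1 if the qubit 43 is the qubit in register 35. *)
Definition single_bit : com :=
  block [:: Defs.Sub 51 43 35; Defs.Sub 52 35 43; Add 51 51 52; Defs.Sub 50 1 51].

Definition single_energy : com := energy_program 40 single_bit.

(* Makes register 30 nonzero if flipping the qubit 23 alone gives an energy below
   the threshold in registers 12 and 13. *)
Definition candidate_bit : com :=
  block [:: Const 36 0; Add 35 23 36; single_energy;
    Add 36 46 13; Add 37 12 47; Defs.Sub 30 37 36].

Definition candidate_energy : com := energy_program 20 candidate_bit.

Definition load_threshold (r : nat) : com :=
  block [:: Const 36 0; Add 35 r 36; single_energy;
    Const 36 0; Add 12 46 36; Add 13 47 36].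

(* Register 6 is the current candidate, register 8 the best one so far, and
   registers 9 and 10 hold the energy of the latter. *)
Definition search_step : com :=
  block [:: load_threshold 6; candidate_energy; Add 36 26 10; Add 37 9 27;
    Defs.Sub 37 37 36;
    If 37 (block [:: Const 36 0; Add 8 6 36; Add 9 26 36; Add 10 27 36]) Skip;
    Add 6 6 1; Defs.Sub 7 7 1].

Definition emit (vs : seq nat) : com :=
  block (flatten [seq [:: Const 36 v; Write 36] | v <- vs]).

Definition output_step : com :=
  block [:: candidate_bit; If 30 (emit (spinor_code true)) (emit (spinor_code false));
    Add 23 23 1; Defs.Sub 7 7 1].

(* The numbers of qubits and of terms are cut off at the length of the input, which
   makes the running time polynomial on malformed inputs too. *)
Definition greedy_program : com :=
  block [:: Const 1 1; Fetch 2 1; Defs.Sub 4 2 0; Defs.Sub 2 2 4;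
    Const 5 2; Fetch 3 5; Defs.Sub 4 3 0; Defs.Sub 3 3 4;
    Const 6 0; Add 7 2 1; Add 8 2 6; Const 9 0; Const 10 0;
    While 7 search_step;
    load_threshold 8; Const 23 0; Const 36 0; Add 7 2 36;
    While 7 output_step].

Variables (n m : nat) (mem : nat -> nat).

Definition in_context (s : machine) : Prop :=
  [/\ regs s 1 = 1, regs s 2 = n, regs s 3 = m & memory s = mem].

Definition part (b : nat -> bool) (off : nat) : nat := energy_part mem n b off m.
Definition at_qubit (u q : nat) : bool := q == u.
(** An energy is a difference of two natural numbers; adding the subtrahends crosswise compares two
    energies without negative numbers. *)
Definition candidate_nat (u q : nat) : bool :=
  part (at_qubit q) 0 + part (at_qubit u) 1 < part (at_qubit u) 0 + part (at_qubit q) 1.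

Lemma keeps_context o s s' : 3 < o -> keeps o s s' -> in_context s -> in_context s'.
Proof.
by move=> o3 [r me w] [h1 h2 h3 h4]; split; rewrite ?me // r //; lia.
Qed.

Definition single_time : nat := energy_time n m 5.

Lemma runs_single_energy s : in_context s ->
  runs single_energy s single_time (fun s' =>
    [/\ keeps 40 s s', regs s' 46 = part (at_qubit (regs s 35)) 0
      & regs s' 47 = part (at_qubit (regs s 35)) 1]).
Proof.
move=> [one rn rm me]; rewrite /part -me.
apply: (@runs_energy 40 single_bit s n m 5 (at_qubit (regs s 35))) => //.
move=> s1 [k1 _ _] _; step; step; step; step; apply: runs_nil; split.
  by do 4![apply: keeps_set_reg => //].
rewrite /= /upd /= (k1 35) // (k1 1) // one /at_qubit -[40 + 3]/43.
by apply/idP/eqP; lia.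
Qed.

Definition candidate_bit_time : nat := single_time + 7.

Lemma runs_candidate_bit u s : in_context s ->
  regs s 12 = part (at_qubit u) 0 -> regs s 13 = part (at_qubit u) 1 ->
  runs candidate_bit s candidate_bit_time (fun s' =>
    keeps 30 s s' /\ (regs s' 30 != 0) = candidate_nat u (regs s 23)).
Proof.
move=> cs t12 t13.
apply: (@runs_weaken _ _ (2 + (single_time + 4)) _ _ _ _ _ (fun _ => id)).
  step; step; set s1 := set_reg _ _ _.
  have ks1 : keeps 30 s s1 by do 2!apply: keeps_set_reg => //.
  have v1 : regs s1 35 = regs s 23 by rewrite /s1 /= /upd /= addn0.
  apply: runs_cons; apply: (runs_weaken (runs_single_energy (keeps_context _ ks1 cs))) => //.
  move=> s2 [k12 r46 r47]; step; step; step; apply: runs_nil.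
  have ks2 : keeps 30 s s2 by apply: keeps_trans ks1 k12.
  split; first by do 3!apply: keeps_set_reg => //.
  rewrite /= /upd /= r46 r47 v1; case: ks2 => k _ _; rewrite !k // t12 t13 /candidate_nat.
  by rewrite -lt0n subn_gt0.
by rewrite /candidate_bit_time; lia.
Qed.

Definition candidate_time : nat := energy_time n m candidate_bit_time.

Lemma runs_candidate_energy u s : in_context s ->
  regs s 12 = part (at_qubit u) 0 -> regs s 13 = part (at_qubit u) 1 ->
  runs candidate_energy s candidate_time (fun s' =>
    [/\ keeps 20 s s', regs s' 26 = part (candidate_nat u) 0
      & regs s' 27 = part (candidate_nat u) 1]).
Proof.
move=> cs t12 t13; case: (cs) => [one rn rm me].
have := @runs_energy 20 candidate_bit s n m candidate_bit_time (candidate_nat u) isT one rn rm.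
rewrite me; apply => // s1 k1 _; have [k _ _] := k1.
apply: runs_candidate_bit; rewrite ?k //.
exact: keeps_context k1 cs.
Qed.

Lemma runs_load_threshold r s : r < 12 -> in_context s ->
  runs (load_threshold r) s (single_time + 8) (fun s' =>
    [/\ keeps 12 s s', regs s' 12 = part (at_qubit (regs s r)) 0
      & regs s' 13 = part (at_qubit (regs s r)) 1]).
Proof.
move=> r12 cs.
apply: (@runs_weaken _ _ (2 + (single_time + 4)) _ _ _ _ _ (fun _ => id)); last by lia.
step; step; set s1 := set_reg _ _ _.
have ks1 : keeps 30 s s1 by do 2!apply: keeps_set_reg => //.
have v1 : regs s1 35 = regs s r.
  by rewrite /s1 set_reg_eq [regs _ 36]set_reg_eq addn0 set_reg_ne //; apply/eqP; lia.
apply: runs_cons; apply: (runs_weaken (runs_single_energy (keeps_context _ ks1 cs))) => //.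
move=> s2 [k12 r46 r47]; step; step; step; apply: runs_nil.
have ks2 : keeps 12 s s2.
  by apply: (@keeps_trans 12 40) k12 => //; apply: (@keeps_trans 12 30) ks1.
split; first by do 3!apply: keeps_set_reg => //.
  by rewrite /= /upd /= addn0 r46 v1.
by rewrite /= /upd /= addn0 r47 v1.
Qed.

Lemma runs_emit vs s : runs (emit vs) s (2 * size vs).+1 (fun s' =>
  [/\ forall i, i != 36 -> regs s' i = regs s i, memory s' = memory s
    & written s' = written s ++ vs]).
Proof.
elim: vs s => [|v vs IH] s; first by apply: runs_nil; rewrite cats0.
rewrite /= mulnS; step; step; apply: runs_weaken (IH _) _ _ => // s' [r me w].
split=> [i i36||]; rewrite ?me ?w ?r //=; first by rewrite /upd (negbTE i36).
by rewrite /upd eqxx cat_rcons.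
Qed.

Definition best_of (b0 b1 u : nat) : Prop :=
  b0 + part (candidate_nat u) 1 <= part (candidate_nat u) 0 + b1.

(** The search starts from the fictitious best energy 0. The first alternative at the end covers the
    time before a candidate of negative energy turns up. *)
Definition search_inv (i : nat) (s : machine) : Prop :=
  [/\ in_context s, regs s 6 = i, regs s 8 <= n /\ written s = [::],
    forall u, u < i -> best_of (regs s 9) (regs s 10) u
    & (regs s 9 = 0 /\ regs s 10 = 0) \/
      (regs s 9 = part (candidate_nat (regs s 8)) 0 /\
       regs s 10 = part (candidate_nat (regs s 8)) 1)].

Definition search_time : nat := single_time + candidate_time + 20.

Lemma runs_search_step i s : i < n.+1 -> regs s 7 = n.+1 - i -> search_inv i s ->
  runs search_step s search_time (fun s' => regs s' 7 = n.+1 - i.+1 /\ search_inv i.+1 s').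
Proof.
move=> lt s7 [cs s6 [s8 sw] best sbest].
apply: (@runs_weaken _ _ (single_time + 8 + (candidate_time + 12)) _ _ _ _ _ (fun _ => id)); last first.
  by rewrite /search_time; lia.
apply: runs_cons; apply: (runs_weaken (@runs_load_threshold 6 s _ cs)) => //.
move=> s1 [k1 t12 t13]; rewrite s6 in t12 t13.
have cs1 := keeps_context (isT : 3 < 12) k1 cs.
apply: runs_cons; apply: (runs_weaken (runs_candidate_energy cs1 t12 t13)) => //.
move=> s2 [k12 r26 r27].
have ks2 : keeps 12 s s2 by apply: (@keeps_trans 12 20) k12.
have cs2 := keeps_context (isT : 3 < 20) k12 cs1.
step; step; step; set s3 := set_reg _ _ _.
have ks3 : keeps 12 s s3 by do 3!apply: keeps_set_reg => //.
have cs3 := keeps_context (isT : 3 < 12) ks3 cs.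
have [k3 m3 w3] := ks3.
have r37 : regs s3 37 = regs s 9 + part (candidate_nat i) 1 - (part (candidate_nat i) 0 + regs s 10).
  by rewrite /s3 /= /upd /= r26 r27; case: ks2 => k _ _; rewrite (k 9) // (k 10).
have r26' : regs s3 26 = part (candidate_nat i) 0 by rewrite /s3 /= /upd /= r26.
have r27' : regs s3 27 = part (candidate_nat i) 1 by rewrite /s3 /= /upd /= r27.
clearbody s3.
have finish s4 : in_context s4 -> regs s4 6 = i -> regs s4 7 = regs s 7 -> regs s4 8 <= n ->
    written s4 = [::] -> (forall u, u < i.+1 -> best_of (regs s4 9) (regs s4 10) u) ->
    (regs s4 9 = 0 /\ regs s4 10 = 0) \/
      (regs s4 9 = part (candidate_nat (regs s4 8)) 0 /\
       regs s4 10 = part (candidate_nat (regs s4 8)) 1) ->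
    runs (block [:: Add 6 6 1; Defs.Sub 7 7 1]) s4 3
      (fun s' => regs s' 7 = n.+1 - i.+1 /\ search_inv i.+1 s').
  move=> [one4 n4 m4 me4] h6 h7 h8 hw hb ho; step; step; apply: runs_nil; split.
    by rewrite /= /upd /= h7 one4 s7; lia.
  by split=> //; rewrite /= /upd /= ?h6 ?one4 ?addn1.
apply: (@runs_cons _ _ s3 6 3); apply: runs_if => r37n; rewrite r37 in r37n.
  step; step; step; step; apply: runs_nil; apply: finish => //=; rewrite /upd /= ?addn0 ?(k3 6) ?(k3 7) ?w3 //.
  - by rewrite s6; lia.
  - move=> u ui; rewrite r26' r27' /best_of.
    have [->|ne] := eqVneq u i; first by [].
    have := best u _; rewrite /best_of => /(_ ltac:(by lia)); lia.
  by right; rewrite s6 r26' r27'.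
exists 1, s3; split=> //; first exact: exec_skip.
apply: finish => //; rewrite ?(k3 6) ?(k3 7) ?(k3 8) ?(k3 9) ?(k3 10) ?w3 //.
move=> u ui; have [->|ne] := eqVneq u i; first by rewrite /best_of; lia.
by apply: best; lia.
Qed.

Definition greedy_output (o : seq nat) : Prop :=
  exists2 u, u <= n & o = flatten [seq spinor_code (candidate_nat u q) | q <- iota 0 n] /\
    ((forall u', u' <= n -> best_of (part (candidate_nat u) 0) (part (candidate_nat u) 1) u') \/
     (forall u', u' <= n -> best_of 0 0 u')).

Definition output_inv (u i : nat) (s : machine) : Prop :=
  [/\ in_context s, regs s 12 = part (at_qubit u) 0, regs s 13 = part (at_qubit u) 1, regs s 23 = i
    & written s = flatten [seq spinor_code (candidate_nat u q) | q <- iota 0 i]].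

Lemma runs_output_step u i s : i < n -> regs s 7 = n - i -> output_inv u i s ->
  runs output_step s (candidate_bit_time + 25)
    (fun s' => regs s' 7 = n - i.+1 /\ output_inv u i.+1 s').
Proof.
move=> lt s7 [cs t12 t13 s23 sw].
apply: runs_cons; apply: (runs_weaken (runs_candidate_bit cs t12 t13)) => // s1 [k1 r30].
rewrite s23 in r30.
have cs1 := keeps_context (isT : 3 < 30) k1 cs.
have [kk km kw] := k1.
apply: (@runs_cons _ _ s1 20 5).
set bc := If _ _ _.
have wE : flatten [seq spinor_code (candidate_nat u q) | q <- iota 0 i.+1] =
    flatten [seq spinor_code (candidate_nat u q) | q <- iota 0 i] ++ spinor_code (candidate_nat u i).
  by rewrite -[i.+1]addn1 iotaD map_cat flatten_cat /= cats0.
suff : runs bc s1 18 (fun s' => [/\ forall j, j != 36 -> regs s' j = regs s1 j,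
    memory s' = memory s1 & written s' = written s1 ++ spinor_code (candidate_nat u i)]).
  move=> h; apply: (runs_weaken h) => // s2 [r2 m2 w2].
  have [one1 n1 m1 me1] := cs1.
  step; step; apply: runs_nil; split.
    by rewrite /= /upd /= !r2 // kk // s7 one1; lia.
  split; rewrite /= /upd /= ?r2 ?kk //.
  - by split; rewrite /= /upd /= ?r2 // m2.
  - by rewrite s23 -(kk 1) // one1 addn1.
  by apply: etrans (esym wE); rewrite w2 kw sw.
apply: runs_if => h; rewrite h /= in r30; rewrite -r30.
  exact: (runs_emit (spinor_code true)).
exact: (runs_emit (spinor_code false)).
Qed.

Definition greedy_time : nat :=
  n.+1 * search_time.+1 + single_time + n * (candidate_bit_time + 26) + 40.

Lemma runs_greedy s : mem = memory s -> n = minn (mem 1) (regs s 0) ->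
  m = minn (mem 2) (regs s 0) -> written s = [::] ->
  runs greedy_program s greedy_time (fun s' => greedy_output (written s')).
Proof.
move=> me nE mE w0.
apply: (@runs_weaken _ _ (13 + ((n.+1 * search_time.+1).+1 + (single_time + 8 +
  (3 + ((n * (candidate_bit_time + 25).+1).+1 + 1))))) _ _ _ _ _ (fun _ => id)); last first.
  by rewrite /greedy_time [n * (_ + 26)]mulnC [n * _.+1]mulnC; lia.
do 13!step; set s1 := set_reg _ _ _.
have c1 : in_context s1.
  rewrite /in_context /s1 /= /upd /= -me; split=> //.
    by rewrite nE /minn; case: ltnP; lia.
  by rewrite mE /minn; case: ltnP; lia.
have [one1 n1 m1 me1] := c1.
have s17 : regs s1 7 = n.+1.
  by rewrite -n1 /s1 /= /upd /= addn1.
have inv0 : search_inv 0 s1.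
  by split=> //; [split=> //; rewrite -n1 /s1 /= /upd /= addn0 | left].
clearbody s1.
apply: runs_cons; apply: (runs_weaken (runs_loop (I := search_inv) s17 inv0 _)).
- by move=> i s' lt r7 inv; apply: runs_search_step.
- by [].
move=> s2 [c2 _ [s28 s2w] best sbest].
apply: runs_cons; apply: (runs_weaken (@runs_load_threshold 8 s2 _ c2)) => //.
move=> s3 [k3 t12 t13]; have c3 := keeps_context (isT : 3 < 12) k3 c2.
set u := regs s2 8 in s28 sbest t12 t13.
step; step; step; set s4 := set_reg _ _ _.
have s47 : regs s4 7 = n by case: c3 => _ h _ _; rewrite /s4 /= /upd /= h addn0.
have inv4 : output_inv u 0 s4.
  have c4 : in_context s4.
    by apply: (@keeps_context 4 s3) c3 => //; do 3!apply: keeps_set_reg => //.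
  split=> //; rewrite /s4 /= /upd //=.
  by case: k3 => _ _ ->.
apply: runs_cons; apply: (runs_weaken (runs_loop (I := output_inv u) s47 inv4 _)).
- by move=> i s' lt r7 inv; apply: runs_output_step.
- by [].
move=> s5 [_ _ _ _ w5]; apply: runs_nil; exists u => //; split=> //.
case: sbest => [[h9 h10]|[h9 h10]]; [right | left] => u' u'n.
  by have := best _ (u'n : u' < n.+1); rewrite h9 h10.
by have := best _ (u'n : u' < n.+1); rewrite h9 h10.
Qed.

End MainProgram.

(** * Polynomial running time *)

Section PolynomialBound.
Local Open Scope nat_scope.

(** The base [s.+1] is at least 1, so that exponents can be enlarged freely, also at [s = 0];
    closure under sums rests on this. *)
Definition poly_bounded (f : nat -> nat) : Prop :=
  exists C e, forall s, f s <= C * s.+1 ^ e.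

Lemma poly_bounded_cst c : poly_bounded (fun=> c).
Proof. by exists c, 0 => s; rewrite muln1. Qed.

Lemma poly_bounded_id : poly_bounded (fun s => s).
Proof. by exists 1, 1 => s; rewrite mul1n expn1. Qed.

Lemma poly_boundedD f g :
  poly_bounded f -> poly_bounded g -> poly_bounded (fun s => f s + g s).
Proof.
move=> [C [e h]] [C' [e' h']]; exists (C + C'), (e + e') => s.
rewrite mulnDl; apply: leq_add.
  by apply: leq_trans (h s) _; rewrite leq_mul // leq_pexp2l ?leq_addr.
by apply: leq_trans (h' s) _; rewrite leq_mul // leq_pexp2l ?leq_addl.
Qed.

Lemma poly_boundedS f : poly_bounded f -> poly_bounded (fun s => (f s).+1).
Proof.
move=> pf; have [C [e h]] := poly_boundedD pf (poly_bounded_cst 1).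
by exists C, e => s; rewrite -addn1.
Qed.

Lemma poly_boundedM f g :
  poly_bounded f -> poly_bounded g -> poly_bounded (fun s => f s * g s).
Proof.
move=> [C [e h]] [C' [e' h']]; exists (C * C'), (e + e') => s.
by rewrite expnD mulnACA leq_mul.
Qed.

(** For [s >= 1] the power of [s.+1] is at most [2 ^ e * s ^ e], and the additive constant covers
    [s = 0]. Positivity of [C] later pays for the single step of the prelude. *)
Lemma poly_bounded_le f : poly_bounded f ->
  exists C e, 0 < C /\ forall s, f s <= C * s ^ e + C.
Proof.
move=> [C [e h]]; exists (C * 2 ^ e).+1, e; split=> // s.
apply: (leq_trans (h s)); case: s => [|s].
  by rewrite exp1n muln1; apply: leq_trans (leq_addl _ _); rewrite ltnW // ltnS leq_pmulr // expn_gt0.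
apply: leq_trans (leq_addr _ _); rewrite mulSn; apply: leq_trans (leq_addl _ _).
rewrite -mulnA -expnMn leq_mul2l; apply/orP; right; case: e {h} => // e.
by rewrite leq_exp2r //; lia.
Qed.

(** The shift accounts for the circuit width, which precedes the input of the postlude. *)
Lemma greedy_time_poly : poly_bounded (fun s => greedy_time s.+1 s.+1).
Proof.
rewrite /greedy_time /search_time /candidate_time /candidate_bit_time /single_time /energy_time.
by repeat first [exact: poly_bounded_cst | exact: poly_bounded_id
  | apply: poly_boundedD | apply: poly_boundedM | apply: poly_boundedS].
Qed.

Lemma leq_energy_time n n' m m' t t' : n <= n' -> m <= m' -> t <= t' ->
  energy_time n m t <= energy_time n' m' t'.
Proof. by move=> nn mm tt; rewrite /energy_time !(leq_add, leq_mul). Qed.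

Lemma leq_greedy_time n n' m m' : n <= n' -> m <= m' -> greedy_time n m <= greedy_time n' m'.
Proof.
move=> nn mm.
have t1 : single_time n m <= single_time n' m' by apply: leq_energy_time.
have t2 : candidate_bit_time n m <= candidate_bit_time n' m' by rewrite leq_add2r.
have t3 : candidate_time n m <= candidate_time n' m' by apply: leq_energy_time.
rewrite /greedy_time /search_time.
by repeat first [by [] | apply: leq_add | apply: leq_mul | rewrite ltnS].
Qed.

End PolynomialBound.

(** * Meaning of the machine's numbers on an encoded Hamiltonian *)

Section Decoding.
Variables (R : realType) (n m : nat) (P : 'I_m -> pauli_term n) (D : nat) (z : 'I_m -> int).
Hypothesis D_gt0 : (0 < D)%N.

Let x := hamiltonian_code P D z.
(** The postlude sees the circuit width 0 first, so [n], [m], [D] stand at addresses 1, 2, 3 and the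
    terms begin at address 4. *)
Let mem := nth 0%N (0%N :: x).

Let block_code (j : 'I_m) : seq nat :=
  [seq pauli_code (P j q) | q <- enum 'I_n] ++ int_code (z j).

Let size_block j : size (block_code j) = (n + 2)%N.
Proof. by rewrite size_cat size_map size_enum_ord; case: (z j). Qed.

Let size_blocks : all (fun s => size s == n + 2)%N [seq block_code j | j <- enum 'I_m].
Proof. by rewrite all_map; apply/allP => j _ /=; rewrite size_block. Qed.

Let memE (j : 'I_m) t : (t < n + 2)%N -> mem (4 + j * (n + 2) + t) = nth 0%N (block_code j) t.
Proof.
move=> tn; rewrite -addnA /mem /x /hamiltonian_code /= (nth_flatten_block _ size_blocks) //.
  by rewrite (nth_map j) ?size_enum_ord // nth_ord_enum.
by rewrite size_map size_enum_ord.
Qed.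

Lemma size_hamiltonian_code : size x = (3 + m * (n + 2))%N.
Proof.
rewrite /x /hamiltonian_code size_cat size_flatten /shape -map_comp sumnE big_map big_enum /=.
rewrite (eq_bigr (fun=> n + 2)%N) => [|j _]; last exact: size_block.
by rewrite sum_nat_const card_ord.
Qed.

Let pauliE (j : 'I_m) (q : 'I_n) : mem (4 + j * (n + 2) + q) = pauli_code (P j q).
Proof.
rewrite memE; last by have := ltn_ord q; lia.
by rewrite nth_cat size_map size_enum_ord ltn_ord (nth_map q) ?size_enum_ord // nth_ord_enum.
Qed.

Let weightE (j : 'I_m) off : (off < 2)%N ->
  mem (4 + j * (n + 2) + n + off) = nth 0%N (int_code (z j)) off.
Proof.
move=> o2; rewrite -addnA memE; last by lia.
by rewrite nth_cat size_map size_enum_ord ltnNge leq_addr /= addKn.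
Qed.

(** The identity has table entry 7, so each of the [n] factors of every term carries a denominator 7
    and all terms share the scale [7 ^+ n]. *)
Lemma part_energy (b : nat -> bool) :
  (part n m mem b 0)%:R - (part n m mem b 1)%:R
  = 7 ^+ n * energy P (fun j => (z j)%:~R) (fun q => b q) :> R.
Proof.
rewrite /part /energy_part !natr_sum -sumrB /energy mulr_sumr; apply: eq_bigr => j _.
rewrite !natrM -mulrBl !weightE //.
have -> : (nth 0%N (int_code (z j)) 0)%:R - (nth 0%N (int_code (z j)) 1)%:R = (z j)%:~R :> R.
  by case: (z j) => v /=; rewrite ?subr0 // sub0r NegzE mulrNz.
rewrite mulrCA; congr (_ * _); rewrite natr_prod /term_value.
rewrite -[n in 7 ^+ n]card_ord -prodr_const -big_split; apply: eq_bigr => q _ /=.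
by rewrite pauliE /bloch mulrCA divff ?mulr1 // pnatr_eq0.
Qed.

Let w (j : 'I_m) : R := (z j)%:~R / D%:R.

Let energyE b : energy P (fun j => (z j)%:~R) b = D%:R * energy P w b :> R.
Proof.
rewrite /energy mulr_sumr; apply: eq_bigr => j _; rewrite mulrA /w mulrCA divff ?mulr1 //.
by rewrite pnatr_eq0 -lt0n.
Qed.

Let scale_gt0 : 0 < 7 ^+ n * D%:R :> R.
Proof. by rewrite mulr_gt0 ?exprn_gt0 // ltr0n. Qed.

Lemma best_of_energy b0 b1 (e : R) u :
  b0%:R - b1%:R = 7 ^+ n * D%:R * e :> R ->
  best_of n m mem b0 b1 u -> e <= energy P w (fun q => candidate_nat n m mem u q).
Proof.
move=> be; rewrite /best_of -(ler_nat R) !natrD => le.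
rewrite -(ler_pM2l scale_gt0) -be -mulrA -energyE -part_energy; lra.
Qed.

(** The integers compared by the machine are the energies times the positive number [7 ^+ n * D]. *)
Lemma candidate_natE u (q : 'I_n) : candidate_nat n m mem u q = candidate P w u q.
Proof.
rewrite /candidate -(ltr_pM2l scale_gt0) -!mulrA -!energyE.
rewrite -[in RHS](part_energy (at_qubit q)) -[in RHS](part_energy (at_qubit u)).
rewrite /candidate_nat -(ltr_nat R) !natrD; apply/idP/idP => ?; lra.
Qed.

(** A candidate of negative energy excludes the case in which the search never improved on its
    initial value 0. *)
Lemma greedy_output_energy o : greedy_output n m mem o ->
  (exists2 u, (u <= n)%N & energy P w (candidate P w u) < 0) ->
  exists2 u, o = state_code (candidate P w u) &
    forall u', (u' <= n)%N -> energy P w (candidate P w u) <= energy P w (candidate P w u').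
Proof.
move=> [u un [-> best]] [v vn v0]; exists u.
  rewrite /state_code -val_enum_ord -map_comp; congr flatten; apply: eq_map => q /=.
  by rewrite candidate_natE.
have cE u' : energy P w (candidate P w u') = energy P w (fun q => candidate_nat n m mem u' q).
  by apply: eq_energy => q; rewrite candidate_natE.
case: best => best u' u'n; last first.
  have := @best_of_energy 0 0 0 v _ (best v vn); rewrite subrr mulr0 => /(_ erefl).
  by rewrite -cE leNgt v0.
rewrite [leRHS]cE; apply: best_of_energy (best u' u'n).
by rewrite part_energy energyE cE mulrA.
Qed.

End Decoding.

(* The prelude writes the empty circuit: the algorithm is classical. *)
Definition greedy_algorithm : quantum_algorithm := QAlg Skip greedy_program.

Lemma computes_skip x : computes Skip x [::] 1.
Proof. by exists (init x) => //; exact: exec_skip. Qed.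

Lemma post_input0 x (y : bit_string (circuit_width [::])) : post_input x y = 0%N :: x.
Proof. by rewrite /post_input (size0nil (s := enum _)) // size_enum_ord. Qed.

Lemma computes_greedy x n m : n = minn (nth 0%N x 1) (size x) -> m = minn (nth 0%N x 2) (size x) ->
  exists o t, [/\ computes greedy_program x o t, (t <= greedy_time n m)%N
    & greedy_output n m (nth 0%N x) o].
Proof.
move=> nE mE.
have [t [s [ex le out]]] := @runs_greedy n m (nth 0%N x) (init x) erefl nE mE erefl.
by exists (written s), t; split=> //; exists s.
Qed.

Lemma size_le_input_size x : (size x <= input_size x)%N.
Proof. by rewrite /input_size -sum1_size; apply: leq_sum. Qed.

Lemma greedy_polynomial_time : polynomial_time greedy_algorithm.
Proof.
have [C [e [C0 bound]]] := poly_bounded_le greedy_time_poly.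
exists C, e => x /=; exists [::], 1%N; split=> //; first exact: computes_skip.
  exact: leq_trans C0 (leq_addl _ _).
move=> y; rewrite post_input0.
have [res [t [co le _]]] := @computes_greedy (0%N :: x) _ _ erefl erefl.
exists res, t; split=> //; apply: (leq_trans le); apply: leq_trans (bound _).
have le_size : (size (0%N :: x) <= (input_size x).+1)%N by rewrite ltnS size_le_input_size.
by apply: leq_greedy_time; apply: leq_trans le_size; apply: geq_minr.
Qed.

(** On zero qubits there is one outcome, and its amplitude is an empty product. *)
Lemma outcome_probability0 (R : realType) (y : bit_string (circuit_width [::])) :
  outcome_probability R y = 1.
Proof.
rewrite /outcome_probability /final_state /= /zero_state mxE.
by rewrite big1 ?normr1 ?expr1n // => -[].
Qed.

Lemma greedy_outputs (R : realType) x (good : seq nat -> Prop) (p : R) : p <= 1 ->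
  (exists o t, computes greedy_program (0%N :: x) o t /\ good o) ->
  outputs_with_probability greedy_algorithm x good p.
Proof.
move=> p1 ex; exists [::], 1%N; split; first exact: computes_skip.
rewrite (eq_bigl xpredT) => [|y]; last by rewrite post_input0; apply/asboolP.
under eq_bigr do rewrite outcome_probability0.
by rewrite sumr_const card_ffun !card_ord expn0 mulr1n lecR.
Qed.

Theorem corollary7 (R : realType) (k : nat) (a b : R) (hk : (1 <= k)%N)
    (ha : 0 < a) (hab : a <= b) :
  exists (c : R) (A : quantum_algorithm),
  [/\ 0 < c, polynomial_time A &
  forall l : nat, (1 <= l)%N ->
  exists2 delta : R, 0 < delta &
  forall eps : R, 0 < eps ->
  exists m0 : nat, forall (m n : nat) (P : 'I_m -> pauli_term n)
    (d : measure_display) (T : measurableType d) (mu : probability T R)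
    (w : 'I_m -> {RV mu >-> R}),
  (m0 <= m)%N ->
  injective P ->
  (forall j : 'I_m, (1 <= locality (P j) <= k)%N) ->
  (forall q : 'I_n, (#|[set j : 'I_m | participates (P j) q]| <= l)%N) ->
  independent_RVs w ->
  (forall j : 'I_m, ('E_mu[w j])%E = 0%E) ->
  (forall j : 'I_m, mu [set om | (a <= `|w j om| <= b)%R]%classic = 1%E) ->
  exists E : set T,
  [/\ measurable E, ((1 - eps)%:E <= mu E)%E &
  forall om : T, E om ->
    let H := hamiltonian P (fun j => w j om) in
    let bound := (- c * m%:R / Num.sqrt l%:R)%:C in
    (exists lambda : R[i], smallest_eigenvalue H lambda /\ lambda <= bound) /\
    forall (D : nat) (z : 'I_m -> int), (0 < D)%N ->
      (forall j : 'I_m, `|(z j)%:~R / D%:R - w j om| <= delta) ->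
      outputs_with_probability A (hamiltonian_code P D z)
        (fun o => exists2 phi : 'I_n -> 'cV[R[i]]_2,
           describes_product_state o phi &
           expectation_value H (tensor_vec phi) <= bound)
        (2 / 3 : R)]].
Proof.
have [c c0 main] := random_weights_candidate hk ha hab.
exists c, greedy_algorithm; split=> //; first exact: greedy_polynomial_time.
move=> l l1; have [delta /andP[delta0 delta_le] main_l] := main l l1.
exists delta => // eps eps0; have [m0 main_m] := main_l eps eps0.
exists m0 => m n P d T mu w m0m _ P_loc P_deg ind mean bd.
have [m_gt0 [E [mE muE good]]] := main_m m n P d T mu w m0m P_loc P_deg ind mean bd.
exists E; split=> // om Eom H bound.
have s0 : 0 < Num.sqrt l%:R :> R by rewrite sqrtr_gt0 ltr0n.
have mR0 : 0 < m%:R :> R by rewrite ltr0n.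
pose r : R := c * m%:R / Num.sqrt l%:R.
have r0 : 0 < r by rewrite divr_gt0 ?mulr_gt0.
have rE2 : 2 * c * m%:R / Num.sqrt l%:R = 2 * r by rewrite /r !mulrA.
have boundE : bound = (- r)%:C by rewrite /bound /r !mulNr.
(* Term values lie in [0, 1], so passing from [w'] to the true weights raises the energy by at most
   [delta * m <= r]. *)
have low (w' : 'I_m -> R) bits : (forall j, `|w' j - w j om| <= delta) ->
    energy P w' bits <= - (2 * r) ->
    expectation_value H (tensor_vec (fun q => normalize (spinor R (bits q)))) <= bound.
  move=> w'P le; rewrite expectation_state_code boundE lecR.
  have : energy P (fun j => w j om) bits <= energy P w' bits + delta * m%:R.
    rewrite -lerBlDl /energy -sumrB -[m in m%:R]card_ord mulr_natr -sumr_const.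
    apply: ler_sum => j _; rewrite -mulrBl.
    have /andP[t0 t1] := term_value_bounds R P j bits.
    apply: (le_trans (ler_norm _)); rewrite normrM distrC [X in _ * X]ger0_norm //.
    by rewrite -[leRHS]mulr1 ler_pM.
  have : delta * m%:R <= r by rewrite /r mulrAC ler_wpM2r // ltW.
  by move=> ? ?; lra.
split.
  have [|u un le] := good om Eom (fun j => w j om) _.
    by move=> j; rewrite subrr normr0 ltW.
  pose phi q := normalize (spinor R (candidate P (fun j => w j om) u q)).
  have [|lambda [eig le_lambda]] := @smallest_eigenvalue_le R _ H (tensor_vec phi)
    (hamiltonian_conj _ _).
    by apply: tensor_vec_norm => q; apply: normalize_norm; apply: spinor_neq0.
  exists lambda; split=> //; apply: (le_trans le_lambda); apply: low (le_trans le _).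
    by move=> j; rewrite subrr normr0 ltW.
  by rewrite rE2.
move=> D z D0 zP; apply: greedy_outputs; first by lra.
pose w' j : R := (z j)%:~R / D%:R.
have [u un le] := good om Eom w' zP.
have sx : size (0%N :: hamiltonian_code P D z) = (4 + m * (n + 2))%N.
  by rewrite -[LHS]/((size (hamiltonian_code P D z)).+1) size_hamiltonian_code.
(* As [m > 0], the code is longer than both [n] and [m], and the cut-off of the program changes
   neither. *)
have [| |res [t [co _ out]]] := @computes_greedy (0%N :: hamiltonian_code P D z) n m.
- by rewrite sx -[nth _ _ _]/n; apply/esym/minn_idPl; apply: leq_trans (leq_addl _ _);
    apply: leq_trans (leq_pmull _ m_gt0); apply: leq_addr.
- by rewrite sx -[nth _ _ _]/m; apply/esym/minn_idPl; apply: leq_trans (leq_addl _ _);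
    rewrite leq_pmulr // addn2.
exists res, t; split=> //.
have [|v oE v_min] := @greedy_output_energy R n m P D z D0 res out.
  by exists u => //; apply: (le_lt_trans le); rewrite rE2; lra.
exists (fun q => normalize (spinor R (candidate P w' v q))).
  by rewrite oE; apply: describes_state_code.
(* The output is optimal among the candidates for the encoded weights, in particular no worse than
   [u]. *)
apply: (low w') => //; apply: le_trans (v_min u un) _.
by rewrite -rE2.
Qed.
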